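(* Let $n\ge 3$ and let $\mathcal{A}$ be an arrangement of $(n-2)$-planes in $\mathbb{P}^n$ whose incidence graph $\Gamma(\mathcal{A})$ is isomorphic to the complete bipartite graph $K_{a,b}$, where $a,b$ are positive integers satisfying one of: $a \le b \le 2$; or $2 \le a \le b \le 3$; or $3 \le a \le b$. Then $\mathcal{A}$ is arithmetically Cohen–Macaulay if and only if $b=a$ or $b=a+1$.
   Context: The ground field is arbitrary. A subspace arrangement is a finite collection of linear subspaces of $\mathbb{P}^n$, each defined over the ground field, with no inclusions among distinct members; $\mathcal{A}$ also denotes the union of these subspaces as a projective variety. The incidence graph $\Gamma(\mathcal{A})$ has vertex set $\mathcal{A}$ and an edge between $X\ne Y$ iff $\dim(X\cap Y)$ exceeds the expected dimension, which for two $(n-2)$-planes in $\mathbb{P}^n$ is $n-4$ (the empty set has dimension $-1$). $K_{a,b}$ is the complete bipartite graph with parts of sizes $a$ and $b$. A projective variety $X\subset\mathbb{P}^n$ is arithmetically Cohen–Macaulay if its homogeneous coordinate ring $k[x_0,\dots,x_n]/I_X$, with $I_X$ the saturated homogeneous ideal of $X$, is a Cohen–Macaulay ring. *)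

(* Defs.v *)
From HB Require Import structures.
From mathcomp Require Import all_boot all_order all_algebra.
From mathcomp Require Import mpoly.
Set Implicit Arguments.
Unset Strict Implicit.
Unset Printing Implicit Defensive.
Import GRing.Theory.
Local Open Scope ring_scope.

Section CommutativeAlgebra.
Variables (k : fieldType) (N : nat).
Notation S := {mpoly k[N]}.

Definition is_ideal (J : S -> Prop) : Prop :=
  [/\ J 0, (forall p q, J p -> J q -> J (p + q)) & (forall r p, J p -> J (r * p))].

Definition is_prime_ideal (J : S -> Prop) : Prop :=
  [/\ is_ideal J, ~ J 1 & (forall p q, J (p * q) -> J p \/ J q)].

Definition is_maximal_ideal (J : S -> Prop) : Prop :=
  [/\ is_ideal J, ~ J 1 &
     (forall J' : S -> Prop, is_ideal J' -> (forall p, J p -> J' p) -> ~ J' 1 ->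
        forall p, J' p -> J p)].

Definition ideal_add_seq (I : S -> Prop) (fs : seq S) (p : S) : Prop :=
  exists q0, I q0 /\ exists cs : seq S, p = q0 + \sum_(i < size fs) cs`_i * fs`_i.

(* fs (lifted to S) is a regular sequence on R = S/I consisting of elements of
   the ideal M (M ⊇ I), i.e. an (M/I)-regular sequence on the R-module R. *)
Definition regular_seq_in (I M : S -> Prop) (fs : seq S) : Prop :=
  [/\ (forall i, (i < size fs)%N -> M fs`_i),
      (forall i, (i < size fs)%N -> forall g,
          ideal_add_seq I (take i fs) (g * fs`_i) -> ideal_add_seq I (take i fs) g)
    & ~ ideal_add_seq I fs 1].

(* a chain P_0 ⊊ P_1 ⊊ ... ⊊ P_d = M of prime ideals of S containing I,
   i.e. a chain of primes of length d in R = S/I ending at M/I *)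
Definition prime_chain_to (I M : S -> Prop) (d : nat) : Prop :=
  exists P : nat -> S -> Prop,
    [/\ (forall i, (i <= d)%N -> is_prime_ideal (P i) /\ (forall p, I p -> P i p)),
        (forall i, (i < d)%N ->
           (forall p, P i p -> P i.+1 p) /\ exists p, P i.+1 p /\ ~ P i p)
      & (forall p, P d p <-> M p)].

(* R = S/I is Cohen–Macaulay: for every maximal ideal M/I of R,
   depth R_M (= grade of M/I on R) >= dim R_M (= height of M/I). *)
Definition CohenMacaulay_quotient (I : S -> Prop) : Prop :=
  forall M : S -> Prop, is_maximal_ideal M -> (forall p, I p -> M p) ->
    forall d, prime_chain_to I M d ->
      exists fs : seq S, size fs = d /\ regular_seq_in I M fs.

End CommutativeAlgebra.

Section Arrangements.
Variables (k : fieldType) (N : nat).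
(* P^n has homogeneous coordinates x_0..x_n: N = n+1.
   A projective linear subspace is represented by the row space of a square
   matrix A : 'M[k]_N (its affine cone in k^N). *)

Definition linform (c : 'rV[k]_N) : {mpoly k[N]} := \sum_(i < N) c 0 i *: 'X_i.

Definition subspace_ideal (A : 'M[k]_N) (p : {mpoly k[N]}) : Prop :=
  exists s : seq ('rV[k]_N * {mpoly k[N]}),
    all (fun x => A *m x.1^T == 0) s /\ p = \sum_(x <- s) x.2 * linform x.1.

Definition arrangement_ideal (m : nat) (A : 'I_m -> 'M[k]_N) (p : {mpoly k[N]}) : Prop :=
  forall i, subspace_ideal (A i) p.

Definition ACM (m : nat) (A : 'I_m -> 'M[k]_N) : Prop :=
  CohenMacaulay_quotient (arrangement_ideal A).
End Arrangements.

(* incidence graph of an arrangement of (n-2)-planes of P^n (vector dim n-1 in k^(n+1)):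
   X ~ Y iff X != Y and projective dim (X ∩ Y) > n-4, i.e. vector dim (X ∩ Y) >= n-2. *)
Definition incident (k : fieldType) (n m : nat) (A : 'I_m -> 'M[k]_(n.+1)) (i j : 'I_m) : bool :=
  (i != j) && (n - 2 <= \rank (A i :&: A j)%MS)%N.

Definition is_left (a b : nat) (x : 'I_a + 'I_b) : bool := if x is inl _ then true else false.
Definition Kab (a b : nat) (x y : 'I_a + 'I_b) : bool := is_left x != is_left y.

(* Main.v *)
Require Import Defs.
From HB Require Import structures.
From mathcomp Require Import all_boot all_order all_algebra.
From mathcomp Require Import ring zify.
From mathcomp Require Import mpoly.
From Stdlib Require Import Classical.
Set Implicit Arguments.
Unset Strict Implicit.
Unset Printing Implicit Defensive.
Import GRing.Theory.
Local Open Scope ring_scope.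

(** Dually, the planes are 2-dimensional spaces l_i (i < a), m_j (j < b) of linear
    forms, skew within each family and meeting across; up to a choice of four
    independent forms x, y, z, w they lie in the two rulings of x w = y z.

    If b is a or a + 1, build the arrangement by adding one plane at a time, going
    through (p, p) and (p, p + 1).  Restricted to the new plane L, the ideal of the
    planes already present is principal: its elements are divisible by the linear
    forms cutting the traces of the other family on L, and their product lifts to a
    product of linear forms in the ideal.  Hence a sequence that is regular modulo
    each plane is regular modulo the arrangement.  There are N - 2 linear forms
    spanning a common complement of all l_i and m_j; at a maximal ideal M, each of
    them is algebraic modulo M by Zariski's lemma, which provides a sequence of
    length N - 2 in M, and no prime chain is longer.

    If b >= a + 2, let gam be a product of b - 2 forms that covers all planes but
    m_0 and m_(b-1), and let beta = b0 + b1 be a form outside all planes, with b0 in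
    m_0 and b1 in m_(b-1).  The forms x, y, z, w multiply gam b1 into (I, beta), but
    gam b1 is not in (I, beta), since gam restricted to m_0 would otherwise extend
    to a form of degree b - 2 vanishing on the b - 1 other planes m_j.  So beta and
    the N - 4 remaining coordinates are a regular sequence modulo which the
    irrelevant ideal consists of zero divisors, and by Koszul cohomology no regular
    sequence in it has length N - 2. *)

(** * Regular sequences and Koszul cohomology *)

Section RegularSequences.
Variable R : comNzRingType.
Implicit Types (J : R -> Prop) (f g h p q : R) (fs gs : seq R).

Definition ideal_pred J : Prop :=
  [/\ J 0, (forall p q, J p -> J q -> J (p + q)) & (forall r p, J p -> J (r * p))].

Lemma ideal_predN J p : ideal_pred J -> J p -> J (- p).
Proof. by case=> _ _ JM Jp; rewrite -mulN1r; apply: JM. Qed.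

Lemma ideal_predB J p q : ideal_pred J -> J p -> J q -> J (p - q).
Proof.
by move=> idJ Jp Jq; case: (idJ) => _ JD _; apply: JD => //; apply: ideal_predN.
Qed.

Lemma ideal_predMr J p q : ideal_pred J -> J p -> J (p * q).
Proof. by case=> _ _ JM Jp; rewrite mulrC; apply: JM. Qed.

Lemma ideal_pred_sum J (I : Type) (r : seq I) (F : I -> R) :
  ideal_pred J -> (forall i, J (F i)) -> J (\sum_(i <- r) F i).
Proof. by case=> J0 JD _ JF; elim/big_ind: _. Qed.

Lemma ideal_pred_congr J p q : ideal_pred J -> J (p - q) -> J q -> J p.
Proof. by case=> _ JD _ Jpq Jq; rewrite -(subrK q p); apply: JD. Qed.

Definition ideal_adjoin J g p : Prop := exists q c, J q /\ p = q + c * g.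

Definition ideal_adjoins J gs : R -> Prop := foldl ideal_adjoin J gs.

Lemma ideal_adjoin_ideal J g : ideal_pred J -> ideal_pred (ideal_adjoin J g).
Proof.
case=> J0 JD JM; split.
- by exists 0, 0; split=> //; rewrite mul0r addr0.
- move=> _ _ [q [c [Jq ->]]] [q' [c' [Jq' ->]]].
  by exists (q + q'), (c + c'); split; [exact: JD | ring].
- move=> r _ [q [c [Jq ->]]].
  by exists (r * q), (r * c); split; [exact: JM | ring].
Qed.

Lemma ideal_adjoin_sub J g p : J p -> ideal_adjoin J g p.
Proof. by move=> Jp; exists p, 0; split=> //; rewrite mul0r addr0. Qed.

Lemma ideal_adjoin_gen J g c : ideal_pred J -> ideal_adjoin J g (c * g).
Proof. by case=> J0 _ _; exists 0, c; rewrite add0r. Qed.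

Lemma eq_ideal_adjoin J J' g : (forall p, J p <-> J' p) ->
  forall p, ideal_adjoin J g p <-> ideal_adjoin J' g p.
Proof.
by move=> eqJ p; split=> -[q [c [/eqJ Jq ->]]]; exists q, c.
Qed.

Lemma ideal_adjoins_ideal J gs : ideal_pred J -> ideal_pred (ideal_adjoins J gs).
Proof.
elim: gs J => [|g gs IHgs] J idJ //=.
exact/IHgs/ideal_adjoin_ideal.
Qed.

Lemma ideal_adjoins_sub J gs p : J p -> ideal_adjoins J gs p.
Proof.
elim: gs J => [|g gs IHgs] J Jp //=.
exact/IHgs/ideal_adjoin_sub.
Qed.

Lemma ideal_adjoins_mem J gs g : ideal_pred J -> g \in gs -> ideal_adjoins J gs g.
Proof.
elim: gs J => // h gs IHgs J idJ; rewrite inE => /orP[/eqP->|gs_g].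
  rewrite /ideal_adjoins /=; apply: ideal_adjoins_sub.
  by have := ideal_adjoin_gen h 1 idJ; rewrite mul1r.
by apply: IHgs => //; apply: ideal_adjoin_ideal.
Qed.

Lemma ideal_adjoins_min J J' gs : ideal_pred J' -> (forall p, J p -> J' p) ->
  {in gs, forall g, J' g} -> forall p, ideal_adjoins J gs p -> J' p.
Proof.
case=> J'0 J'D J'M; elim: gs J => [|g gs IHgs] J sJJ' J'gs //=.
apply: IHgs => [_ [q [c [Jq ->]]]|h gs_h]; last by apply: J'gs; rewrite inE gs_h orbT.
by apply: J'D; [apply: sJJ' | apply: J'M; apply: J'gs; rewrite inE eqxx].
Qed.

(** The last quotient may be zero, so the unit ideal is a valid start for the induction that adds
    planes one by one; properness comes separately, from the maximal ideal. *)
Fixpoint weakly_regular J fs : Prop :=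
  if fs is f :: fs' then
    (forall h, J (h * f) -> J h) /\ weakly_regular (ideal_adjoin J f) fs'
  else True.

Lemma eq_weakly_regular J J' fs : (forall p, J p <-> J' p) ->
  weakly_regular J fs -> weakly_regular J' fs.
Proof.
elim: fs J J' => //= f fs IHfs J J' eqJ [regf regfs]; split=> [h /eqJ/regf/eqJ //|].
by apply: IHfs regfs; apply: eq_ideal_adjoin.
Qed.

(* The short exact sequence 0 -> R/J2 -> R/J -> R/J1 -> 0, whose first map is
   multiplication by e, remains exact modulo an element that is regular on the
   outer terms. *)
Lemma weakly_regular_extension J J1 J2 e fs : ideal_pred J ->
  (forall p, J1 p <-> ideal_adjoin J e p) -> (forall p, J2 p <-> J (p * e)) ->
  weakly_regular J1 fs -> weakly_regular J2 fs -> weakly_regular J fs.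
Proof.
elim: fs J J1 J2 => //= f fs IHfs J J1 J2 idJ eqJ1 eqJ2 [reg1 regs1] [reg2 regs2].
have [J0 JD JM] := idJ.
split=> [h Jhf|].
  have /eqJ1[q [c [Jq def_h]]] : J1 h by apply/reg1/eqJ1/ideal_adjoin_sub.
  rewrite def_h; apply: JD => //; apply/eqJ2/reg2/eqJ2.
  apply: (ideal_pred_congr (q := h * f - f * q)) => //; last first.
    by apply: ideal_predB => //; apply: JM.
  suff -> : c * f * e - (h * f - f * q) = 0 by [].
  by rewrite def_h; ring.
apply: (IHfs _ _ _ _ _ _ regs1 regs2) => [|p|p]; first exact: ideal_adjoin_ideal.
  split=> [[q [c [/eqJ1[r [d [Jr ->]]] ->]]]|[q [c [[r [d [Jr ->]] ->]]]]].
    exists (r + c * f), d; split; last by ring.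
    by exists r, c.
  exists (r + c * e), d; split; last by ring.
  by apply/eqJ1; exists r, c.
split=> [[q [c [/eqJ2 Jqe ->]]]|[q [c [Jq def_pe]]]].
  by exists (q * e), (c * e); split=> //; ring.
(* Since [p * e = q + c * f], the product [c * f] lies in [J1], hence so does [c]: multiplication by
   [e] stays injective after reduction modulo [f]. *)
have /reg1/eqJ1[r [d [Jr def_c]]] : J1 (c * f).
  apply/eqJ1; exists (- q), p; split; first exact: ideal_predN.
  by rewrite def_pe; ring.
exists (p - d * f), d; split; last by ring.
apply/eqJ2; have -> : (p - d * f) * e = q + f * r.
  by rewrite mulrBl def_pe def_c; ring.
by apply: JD => //; apply: JM.
Qed.

End RegularSequences.

Section Koszul.
Variable R : comNzRingType.
Implicit Types (J : R -> Prop) (f g u : R) (fs gs : seq R).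

(* The Koszul cochains on s elements, as a tower of mapping cones: the first
   component has the degree of the pair, the second one degree less. *)
Fixpoint koszul (s : nat) : lmodType R :=
  if s is s'.+1 then (koszul s' * koszul s')%type else R^o.

Fixpoint koszul_diff fs : koszul (size fs) -> koszul (size fs) :=
  match fs return koszul (size fs) -> koszul (size fs) with
  | [::] => fun=> 0
  | f :: fs' => fun x : koszul (size fs') * koszul (size fs') =>
      (koszul_diff x.1, f *: x.1 - koszul_diff x.2)
  end.

Fixpoint koszul_in J s : koszul s -> Prop :=
  match s return koszul s -> Prop with
  | 0 => fun x : R => J x
  | s'.+1 => fun x : koszul s' * koszul s' => koszul_in J x.1 /\ koszul_in J x.2
  end.

(** Cochains need not be homogeneous; the components of degree [d] and above vanish. For [d = 0]
    nothing survives, so the truncated predecessor is harmless. *)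
Fixpoint koszul_deg_lt s (d : nat) : koszul s -> Prop :=
  match s return koszul s -> Prop with
  | 0 => fun x : R => d = 0%N -> x = 0
  | s'.+1 => fun x : koszul s' * koszul s' =>
      koszul_deg_lt d x.1 /\ koszul_deg_lt d.-1 x.2
  end.

(** Vanishing of the Koszul cohomology of [fs] on [R / J] in every degree below [d]. *)
Definition koszul_acyclic J fs d : Prop := forall x : koszul (size fs),
  koszul_deg_lt d x -> koszul_in J (koszul_diff x) ->
  exists2 z, koszul_deg_lt d.-1 z & koszul_in J (x - koszul_diff z).

Lemma koszul_diffZ fs c (x : koszul (size fs)) :
  koszul_diff (c *: x) = c *: koszul_diff x.
Proof.
elim: fs x => [|f fs IHfs] /= x; first by rewrite scaler0.
by congr (_, _); rewrite /= ?IHfs // scalerBr !scalerA mulrC.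
Qed.

Lemma koszul_diffB fs (x y : koszul (size fs)) :
  koszul_diff (x - y) = koszul_diff x - koszul_diff y.
Proof.
elim: fs x y => [|f fs IHfs] /= x y; first by rewrite subr0.
by congr (_, _); rewrite /= ?IHfs // scalerBr !opprD !opprK addrACA.
Qed.

Lemma koszul_diffK fs (x : koszul (size fs)) : koszul_diff (koszul_diff x) = 0.
Proof.
elim: fs x => [|f fs IHfs] //= x; congr (_, _) => //=.
by rewrite koszul_diffB koszul_diffZ !IHfs subr0 subrr.
Qed.

Lemma koszul_deg_lt0 s (x : koszul s) : koszul_deg_lt 0 x -> x = 0.
Proof.
elim: s x => [|s IHs] //= x; first by apply.
by case: x => x y [/= /IHs-> /IHs->].
Qed.

Lemma koszul_deg_lt_zero s d : @koszul_deg_lt s d 0.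
Proof. by elim: s d => //= s IHs d; split; apply: IHs. Qed.

Lemma koszul_deg_ltB s d (x y : koszul s) :
  koszul_deg_lt d x -> koszul_deg_lt d y -> koszul_deg_lt d (x - y).
Proof.
elim: s d x y => [|s IHs] d x y /=; last by case=> ? ? [? ?]; split; apply: IHs.
by move=> x0 y0 d0; rewrite x0 // y0 // subrr.
Qed.

Lemma koszul_deg_ltZ s d c (x : koszul s) :
  koszul_deg_lt d x -> koszul_deg_lt d (c *: x).
Proof.
elim: s d x => [|s IHs] d x /=; last by case=> ? ?; split; apply: IHs.
by move=> x0 d0; rewrite x0 // scaler0.
Qed.

Lemma koszul_deg_lt_diff fs d (x : koszul (size fs)) :
  koszul_deg_lt d.-1 x -> koszul_deg_lt d (koszul_diff x).
Proof.
case: d => [/koszul_deg_lt0->|d] /=.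
  rewrite -(scale0r (0 : koszul (size fs))) koszul_diffZ scale0r.
  exact: koszul_deg_lt_zero.
elim: fs d x => [|f fs IHfs] d //= x [dx1 dx2]; split; first exact: IHfs.
apply: koszul_deg_ltB; first exact: koszul_deg_ltZ.
case: d dx1 dx2 => [|d] dx1 dx2; last exact: IHfs.
rewrite (koszul_deg_lt0 dx2) -(scale0r (0 : koszul (size fs))) koszul_diffZ scale0r.
exact: koszul_deg_lt_zero.
Qed.

Section Ideal.
Variable J : R -> Prop.
Hypothesis idJ : ideal_pred J.

Lemma koszul_in0 s : @koszul_in J s 0.
Proof. by case: idJ => J0 _ _; elim: s => //= s IHs; split. Qed.

Lemma koszul_inD s (x y : koszul s) :
  koszul_in J x -> koszul_in J y -> koszul_in J (x + y).
Proof.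
case: idJ => _ JD _; elim: s x y => [|s IHs] x y /=; first exact: JD.
by case=> ? ? [? ?]; split; apply: IHs.
Qed.

Lemma koszul_inZ s c (x : koszul s) : koszul_in J x -> koszul_in J (c *: x).
Proof.
case: idJ => _ _ JM; elim: s x => [|s IHs] x /=; first exact: JM.
by case=> ? ?; split; apply: IHs.
Qed.

Lemma koszul_inB s (x y : koszul s) :
  koszul_in J x -> koszul_in J y -> koszul_in J (x - y).
Proof. by move=> ? ?; rewrite -scaleN1r; apply/koszul_inD/koszul_inZ. Qed.

Lemma koszul_in_diff fs (x : koszul (size fs)) :
  koszul_in J x -> koszul_in J (koszul_diff x).
Proof.
elim: fs x => [|f fs IHfs] x /=; first by case: idJ.
by case=> ? ?; split; [apply: IHfs | apply: koszul_inB; [apply: koszul_inZ | apply: IHfs]].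
Qed.

Lemma koszul_in_regular s f (x : koszul s) : (forall h, J (h * f) -> J h) ->
  koszul_in J (f *: x) -> koszul_in J x.
Proof.
move=> regf; elim: s x => [|s IHs] x /=; last by case=> ? ?; split; apply: IHs.
by rewrite [_ *: _]mulrC; apply: regf.
Qed.

Lemma koszul_in_sub g s (x : koszul s) :
  koszul_in J x -> koszul_in (ideal_adjoin J g) x.
Proof.
elim: s x => [|s IHs] x /=; first exact: ideal_adjoin_sub.
by case=> ? ?; split; apply: IHs.
Qed.

Lemma koszul_in_mul g s (x : koszul s) : koszul_in (ideal_adjoin J g) (g *: x).
Proof.
elim: s x => [|s IHs] x /=; last by split; apply: IHs.
by rewrite [_ *: _]mulrC; apply: ideal_adjoin_gen.
Qed.

Lemma koszul_in_adjoin g d s (x : koszul s) : koszul_deg_lt d x ->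
  koszul_in (ideal_adjoin J g) x ->
  exists2 w, koszul_deg_lt d w & koszul_in J (x - g *: w).
Proof.
elim: s d x => [|s IHs] d x /=.
  case: d => [x0 _|d _ [q [c [Jq ->]]]].
    exists 0 => //; rewrite x0 // scaler0 subrr; exact: (@koszul_in0 0).
  by exists c => //; rewrite [_ *: _]mulrC addrK.
case=> dx1 dx2 [/(IHs _ _ dx1)[w1 dw1 Jw1] /(IHs _ _ dx2)[w2 dw2 Jw2]].
by exists (w1, w2).
Qed.

End Ideal.

(** Long exact sequence of [0 -> R/J -> R/J -> R/(J,g) -> 0], whose first map is multiplication by
    [g]: cohomology of [R/(J,g)] in degree i lies between that of [R/J] in degrees i and i + 1. *)
Lemma koszul_acyclic_adjoin J g fs d : ideal_pred J -> (forall h, J (h * g) -> J h) ->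
  koszul_acyclic J fs d.+1 -> koszul_acyclic J fs d ->
  koszul_acyclic (ideal_adjoin J g) fs d.
Proof.
move=> idJ regg acS ac x dx Jdx.
have dS_dx : koszul_deg_lt d.+1 (koszul_diff x) by apply: koszul_deg_lt_diff.
(* [y] represents the image of [x] under the connecting map; once it is the boundary of some [z],
   the cochain [x - g *: z] is a cocycle modulo [J]. *)
have [y dy Jy] := koszul_in_adjoin idJ dS_dx Jdx.
have Jddy : koszul_in J (koszul_diff y).
  apply: (koszul_in_regular regg).
  have := koszul_in_diff idJ Jy.
  rewrite koszul_diffB koszul_diffK koszul_diffZ sub0r => /(koszul_inZ idJ (-1)).
  by rewrite scaleN1r opprK.
have [z dz Jz] := acS y dy Jddy.
have [||w dw Jw] := ac (x - g *: z).
- by apply: koszul_deg_ltB => //; apply: koszul_deg_ltZ.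
- rewrite koszul_diffB koszul_diffZ.
  have -> : koszul_diff x - g *: koszul_diff z =
            (koszul_diff x - g *: y) + g *: (y - koszul_diff z).
    by rewrite scalerBr addrA subrK.
  by apply: koszul_inD => //; apply: koszul_inZ.
exists w => //.
have -> : x - koszul_diff w = (x - g *: z - koszul_diff w) + g *: z.
  by rewrite addrAC subrK.
apply: koszul_inD; first exact: ideal_adjoin_ideal.
  exact: koszul_in_sub.
exact: koszul_in_mul.
Qed.

(** The complex of [f :: fs] is the cone of multiplication by [f] on that of [fs]; as [f] is
    regular, its cohomology is that of [fs] modulo [(J, f)], shifted by one degree. *)
Lemma koszul_acyclic_regular J fs d : ideal_pred J -> (d <= size fs)%N ->
  weakly_regular J fs -> koszul_acyclic J fs d.
Proof.
elim: fs d J => [|f fs IHfs] d J idJ /=.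
  rewrite leqn0 => /eqP-> _ x /koszul_deg_lt0 -> _.
  exists 0; first exact: koszul_deg_lt_zero.
  by rewrite subr0; case: idJ.
case: d => [_ _ x /koszul_deg_lt0-> _|d led [regf regfs]].
  exists 0; first exact: koszul_deg_lt_zero.
  by apply: koszul_inB => //; [|apply: koszul_in_diff => //]; apply: koszul_in0.
move=> [x1 x2] /= [dx1 dx2] [/= Jdx1 Jfx].
have [||z dz Jz] := IHfs d _ (ideal_adjoin_ideal f idJ) led regfs x2 => //.
  have -> : koszul_diff x2 = f *: x1 - (f *: x1 - koszul_diff x2).
    by rewrite opprB addrC subrK.
  apply: koszul_inB; first exact: ideal_adjoin_ideal.
    exact: koszul_in_mul.
  exact: koszul_in_sub.
(* What is left of [x2] is [f *: w] modulo [J]. Then [(w, - z)] bounds the pair; in the first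
   component this is checked after multiplication by the regular element [f]. *)
have [|w dw Jw] := koszul_in_adjoin (d := d) idJ _ Jz.
  by apply: koszul_deg_ltB => //; apply: koszul_deg_lt_diff.
exists (w, - z); first by split=> //=; rewrite -scaleN1r; apply: koszul_deg_ltZ.
split=> /=.
  apply: (koszul_in_regular regf); rewrite scalerBr.
  have -> : f *: x1 - f *: koszul_diff w =
     (f *: x1 - koszul_diff x2) + koszul_diff (x2 - koszul_diff z - f *: w).
    by rewrite !koszul_diffB koszul_diffK koszul_diffZ subr0 addrA subrK.
  by apply: koszul_inD => //; apply: koszul_in_diff.
have -> : x2 - (f *: w - koszul_diff (- z)) = x2 - koszul_diff z - f *: w => //.
by rewrite -[- z]scaleN1r koszul_diffZ scaleN1r opprK opprD addrA addrAC.
Qed.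

Fixpoint koszul_const s : R -> koszul s :=
  if s is s'.+1 then fun u => (koszul_const s' u, 0) else fun u => u.

(** Cohomology in degree 0 consists of the elements that [fs] multiplies into [J]: the constant
    cochain of [u] is a cocycle, and only 0 is available as a primitive. *)
Lemma koszul_acyclic1 J fs u : ideal_pred J -> koszul_acyclic J fs 1 ->
  {in fs, forall f, J (f * u)} -> J u.
Proof.
move=> idJ ac Jfu; have [J0 _ _] := idJ.
have [||z /koszul_deg_lt0->] := ac (koszul_const (size fs) u).
- by elim: (size fs) => //= s IHs; split=> //=; apply: koszul_deg_lt_zero.
- elim: fs Jfu {ac} => [|f fs IHfs] //= Jfu; split=> /=.
    by apply: IHfs => g fs_g; apply: Jfu; rewrite inE fs_g orbT.
  apply: koszul_inB => //; last by apply/koszul_in_diff/koszul_in0.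
  have {Jfu IHfs}: J (f * u) by apply: Jfu; rewrite inE eqxx.
  by elim: (size fs) => //= s IHs Jfu; split; [apply: IHs | rewrite /= scaler0; apply: koszul_in0].
rewrite -(scale0r (0 : koszul (size fs))) koszul_diffZ scale0r subr0.
by elim: (size fs) => //= s IHs [/IHs].
Qed.

(* Each term of gs lowers by one the range in which the Koszul complex of fs is
   acyclic. *)
Lemma weakly_regular_length J fs gs u : ideal_pred J ->
  weakly_regular J fs -> weakly_regular J gs -> (size gs < size fs)%N ->
  {in fs, forall f, ideal_adjoins J gs (f * u)} -> ideal_adjoins J gs u.
Proof.
move=> idJ regfs reggs lt_gf; apply: koszul_acyclic1.
  exact: ideal_adjoins_ideal.
have: forall d, (d <= (size gs).+1)%N -> koszul_acyclic J fs d.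
  by move=> d led; apply: koszul_acyclic_regular => //; apply: leq_trans led lt_gf.
elim: gs J idJ reggs {regfs lt_gf} => [|g gs IHgs] J idJ /= reggs ac; first exact: ac.
case: reggs => regg reggs; apply: IHgs => [|//|d led]; first exact: ideal_adjoin_ideal.
by apply: koszul_acyclic_adjoin => //; apply: ac; rewrite // ltnW.
Qed.

End Koszul.

(** * Ideals generated by linear forms *)

Section LinearIdeals.
Variables (k : fieldType) (N : nat).
Local Notation S := {mpoly k[N]}.
Implicit Types (p q : S) (u v : 'rV[k]_N).

Lemma mpoly_ring_ind (P : S -> Prop) :
    (forall c, P c%:MP) -> (forall i, P 'X_i) ->
    (forall p q, P p -> P q -> P (p + q)) ->
    (forall p q, P p -> P q -> P (p * q)) ->
  forall p, P p.
Proof.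
move=> PC PX PD PM p; rewrite (mpolyE p).
elim/big_ind: _ => [||m _]; first by rewrite -mpolyC0; apply: PC.
  exact: PD.
rewrite -mul_mpolyC; apply: (PM) => //; rewrite mpolyXE_id.
elim/big_ind: _ => [||i _]; first by rewrite -mpolyC1; apply: PC.
  exact: (PM).
by elim: (m i) => [|e IHe]; rewrite ?expr0 ?exprS -?mpolyC1; [apply: PC | apply: PM].
Qed.

Lemma linform_is_linear : linear (@linform k N).
Proof.
move=> c u v; rewrite /linform scaler_sumr -big_split /=.
by apply: eq_bigr => i _; rewrite !mxE scalerDl scalerA.
Qed.

HB.instance Definition _ :=
  GRing.isLinear.Build k 'rV[k]_N S *:%R (@linform k N) linform_is_linear.

Lemma linform_delta i : linform (delta_mx 0 i) = 'X_i :> S.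
Proof.
rewrite /linform (bigD1 i) //= mxE !eqxx scale1r big1 ?addr0 // => j ne_ji.
by rewrite mxE (negPf ne_ji) scale0r.
Qed.

Lemma linform_inj : injective (@linform k N).
Proof.
apply: raddf_inj => u u0; apply/rowP => i; rewrite mxE.
have: (linform u)@_U_(i) = 0 by rewrite u0 mcoeff0.
rewrite /linform raddf_sum /= (bigD1 i) //= mcoeffZ mcoeffXU eqxx mulr1.
rewrite big1 ?addr0 // => j ne_ji.
by rewrite mcoeffZ mcoeffXU (negPf ne_ji) mulr0.
Qed.

Lemma linform_eq0 v : (linform v == 0) = (v == 0).
Proof. by rewrite -(inj_eq linform_inj) linear0. Qed.

Lemma rmorph_linform (R : comNzRingType) (h : {rmorphism k -> R}) (f : 'I_N -> R) v :
  mmap h f (linform v) = \sum_i h (v 0 i) * f i.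
Proof.
rewrite /linform rmorph_sum /=; apply: eq_bigr => i _.
by rewrite mmapZ mmapX mmap1U.
Qed.

Definition lin_subst (P : 'M[k]_N) : S -> S :=
  mmap (@mpolyC N k) (fun i => linform (row i P)).

HB.instance Definition _ (P : 'M[k]_N) := GRing.RMorphism.on (lin_subst P).

Lemma lin_subst_linform P v : lin_subst P (linform v) = linform (v *m P).
Proof.
rewrite /lin_subst rmorph_linform mulmx_sum_row linear_sum /=.
by apply: eq_bigr => i _; rewrite linearZ /= mul_mpolyC.
Qed.

Lemma lin_substC P c : lin_subst P c%:MP = c%:MP.
Proof. exact: mmapC. Qed.

Lemma lin_substX P i : lin_subst P 'X_i = linform (row i P).
Proof. by rewrite /lin_subst mmapX mmap1U. Qed.

Section Ideal.
Variables (r : nat) (B : 'M[k]_(r, N)).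

Definition lin_ideal p : Prop := exists s : seq ('rV[k]_N * S),
  all (fun x => (x.1 <= B)%MS) s /\ p = \sum_(x <- s) x.2 * linform x.1.

Lemma lin_ideal_ideal : ideal_pred lin_ideal.
Proof.
split=> [|_ _ [s [sB ->]] [t [tB ->]]|q _ [s [sB ->]]].
- by exists [::]; rewrite big_nil.
- by exists (s ++ t); rewrite all_cat sB tB big_cat.
- exists [seq (x.1, q * x.2) | x <- s]; split; first by rewrite all_map.
  by rewrite big_map mulr_sumr; apply: eq_bigr => x _ /=; rewrite mulrA.
Qed.

Lemma lin_ideal_mul v q : (v <= B)%MS -> lin_ideal (q * linform v).
Proof. by move=> vB; exists [:: (v, q)]; rewrite /= vB big_seq1. Qed.

Lemma lin_ideal_linform v : (v <= B)%MS -> lin_ideal (linform v).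
Proof. by move=> vB; rewrite -[linform v]mul1r; apply: lin_ideal_mul. Qed.

Lemma lin_ideal_min (J : S -> Prop) : ideal_pred J ->
  (forall v, (v <= B)%MS -> J (linform v)) -> forall p, lin_ideal p -> J p.
Proof.
case=> J0 JD JM JB _ [s [sB ->]]; elim: s sB => [|x s IHs] /=; first by rewrite big_nil.
by case/andP=> xB sB; rewrite big_cons; apply: JD; [apply/JM/JB | apply: IHs].
Qed.

Lemma lin_subst_mod P p : (1%:M - P <= B)%MS -> lin_ideal (p - lin_subst P p).
Proof.
move=> PB; have [_ JD JM] := lin_ideal_ideal.
elim/mpoly_ring_ind: p => [c|i|p q Ip Iq|p q Ip Iq].
- by rewrite lin_substC subrr; case: lin_ideal_ideal.
- rewrite lin_substX -linform_delta -linearB /=; apply: lin_ideal_linform.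
  by rewrite rowE -{1}[delta_mx 0 i]mulmx1 -mulmxBr (submx_trans (submxMl _ _)).
- by rewrite rmorphD opprD addrACA; apply: JD.
- rewrite rmorphM.
  have -> : p * q - lin_subst P p * lin_subst P q =
    q * (p - lin_subst P p) + lin_subst P p * (q - lin_subst P q) by ring.
  by apply: JD; apply: JM.
Qed.

(** Right multiplication by [P] kills the row space of [B] and changes any form only by an element
    of that space. The ideal is thus the kernel of an endomorphism of the domain [S], whence its
    primality. *)
Let P := 1%:M - pinvmx B *m B.

Lemma lin_idealP p : lin_ideal p <-> lin_subst P p = 0.
Proof.
split.
  apply: (@lin_ideal_min (fun p => lin_subst P p = 0)); first split=> [|p0 q p00 q0|q p0 p00].
  - by rewrite rmorph0.
  - by rewrite rmorphD /= p00 q0 addr0.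
  - by rewrite rmorphM /= p00 mulr0.
  move=> v vB; rewrite lin_subst_linform /P mulmxBr mulmx1 mulmxA mulmxKpV //.
  by rewrite subrr linear0.
move=> p0; rewrite -[p]subr0 -p0; apply: lin_subst_mod.
by rewrite /P opprB addrC subrK submxMl.
Qed.

Lemma lin_ideal_prime : is_prime_ideal lin_ideal.
Proof.
split; first exact: lin_ideal_ideal.
  by move/lin_idealP/eqP; rewrite rmorph1 oner_eq0.
move=> p q /lin_idealP/eqP; rewrite rmorphM mulf_eq0.
by case/orP => /eqP /lin_idealP; [left | right].
Qed.

Lemma lin_ideal_linformE v : lin_ideal (linform v) -> (v <= B)%MS.
Proof.
move/lin_idealP/eqP; rewrite lin_subst_linform linform_eq0 /P mulmxBr mulmx1 subr_eq0.
by move/eqP->; rewrite mulmxA submxMl.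
Qed.

End Ideal.

Lemma lin_idealS r1 r2 (B1 : 'M[k]_(r1, N)) (B2 : 'M[k]_(r2, N)) p :
  (B1 <= B2)%MS -> lin_ideal B1 p -> lin_ideal B2 p.
Proof.
move=> sB; apply: lin_ideal_min; first exact: lin_ideal_ideal.
by move=> v vB; apply: lin_ideal_linform; apply: submx_trans sB.
Qed.

Lemma lin_ideal_addr r (B : 'M[k]_(r, N)) v p :
  lin_ideal (v + B)%MS p <-> ideal_adjoin (lin_ideal B) (linform v) p.
Proof.
split.
  apply: lin_ideal_min; first exact/ideal_adjoin_ideal/lin_ideal_ideal.
  move=> w /sub_addsmxP[[a b] /= ->]; exists (linform (b *m B)), (a 0 0)%:MP.
  split; first by apply/lin_ideal_linform/submxMl.
  by rewrite linearD addrC /= {1}[a]mx11_scalar mul_scalar_mx linearZ /= mul_mpolyC.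
have [J0 JD JM] := lin_ideal_ideal (v + B)%MS.
case=> q [c [Bq ->]]; apply: JD; first by apply: lin_idealS Bq; apply: addsmxSr.
by apply: lin_ideal_mul; apply: addsmxSl.
Qed.

(** Passage to the dual side: from here on a plane is replaced by the space of linear forms that
    vanish on it. *)
Lemma subspace_idealE (A : 'M[k]_N) p :
  subspace_ideal A p <-> lin_ideal (kermx A^T) p.
Proof.
have kerE v : (A *m v^T == 0) = (v <= kermx A^T)%MS.
  by rewrite sub_kermx -trmx_eq0 trmx_mul trmxK.
by split=> -[s [sA ->]]; exists s; split=> //; rewrite -(eq_all (fun x => kerE x.1)) in sA *.
Qed.

End LinearIdeals.

(** * Zariski's lemma *)

(** As a function of x, [\det (a%:M - x *: A)] is a polynomial with value [a ^+ r] at 0; the factor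
    theorem is then evaluated at [g]. *)
Lemma det_scalar_sub (B : comNzRingType) (a g : B) r (A : 'M[B]_r) :
  exists h, \det (a%:M - g *: A) = a ^+ r + g * h.
Proof.
pose p := \det (map_mx polyC a%:M - 'X *: map_mx polyC A).
have pE x : p.[x] = \det (a%:M - x *: A).
  rewrite -[p.[x]]/(horner_eval x p) -det_map_mx; congr (\det _).
  by apply/matrixP=> i j; rewrite !mxE /= /horner_eval !hornerE.
have /factor_theorem[q def_p] : root (p - p.[0]%:P) 0.
  by rewrite rootE !hornerE subrr.
exists q.[g]; have := congr1 (fun f => f.[g]) def_p.
rewrite hornerD hornerN hornerC hornerM hornerXsubC subr0 !pE scale0r subr0 det_scalar => /eqP.
by rewrite subr_eq => /eqP->; ring.
Qed.

(** Modulo [1 + 'X * c] the element [- 'X * c] is 1, so a divisor of this shape of a power of [c]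
    would be a unit by the geometric sum, although its degree is positive. *)
Lemma poly_pow_notdiv (B : idomainType) (c h : {poly B}) m :
  c != 0 -> c ^+ m <> (1 + 'X * c) * h.
Proof.
move=> nz_c def_cm; set g := 1 + 'X * c in def_cm.
have size_g : size g = (size c).+1.
  by rewrite /g addrC [_ * c]mulrC -polyC1 size_MXaddC (negPf nz_c).
have /esym def_1 : 1 = g * ((- 'X) ^+ m * h + \sum_(i < m) (- 'X * c) ^+ i) :> {poly B}.
  have := subrX1 (- 'X * c) m; rewrite exprMn def_cm => /eqP.
  rewrite subr_eq => /eqP def_gh.
  by rewrite mulrDr mulrCA def_gh /g; ring.
have := congr1 (size \o val) def_1; rewrite /= size_poly1.
set y := (_ + _) in def_1 *; have nz_y : y != 0.
  by apply: contra_eq_neq def_1 => ->; rewrite mulr0 eq_sym oner_eq0.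
have nz_g : g != 0 by rewrite -size_poly_gt0 size_g.
rewrite size_mul // size_g addSn /= => size1.
by move: nz_c nz_y; rewrite -!size_poly_gt0; case: (size c) size1 => // -[|?]; case: (size y).
Qed.

Section AlgebraicMod.
Variables (S : comNzRingType) (M : S -> Prop).
Hypothesis idM : ideal_pred M.

(** The quotient [S / M] is never formed: injectivity and, below, algebraicity and spanning are read
    modulo the predicate [M]. *)
Definition inj_mod (B : nzRingType) (phi : B -> S) : Prop := forall b, M (phi b) -> b = 0.

Definition alg_mod (B : nzRingType) (phi : B -> S) (z : S) : Prop :=
  exists F : {poly B}, F != 0 /\ M (map_poly phi F).[z].

(** A transcendence basis is extracted greedily, starting from [t]: each further element is either
    algebraic or becomes a new variable. Because of [t] the base is a genuine polynomial ring, so it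
    has nonconstant elements to invert. *)
Lemma transcendental_tower (k : fieldType) (iota : {rmorphism k -> S}) (t : S) (zs : seq S) :
  ~ alg_mod iota t ->
  exists (B : idomainType) (phi : {rmorphism {poly B} -> S}),
    [/\ inj_mod phi, forall a, exists b, phi b = iota a
      & {in zs, forall z, alg_mod phi z}].
Proof.
move=> trans_t; elim: zs => [|z zs [B [phi [inj_phi iotaP algzs]]]].
  have cp : commr_rmorph iota t by move=> a; apply: mulrC.
  exists k, (horner_morph cp); split=> // [b Mb|a]; last first.
    by exists a%:P; apply: horner_morphC.
  by apply: NNPP => /eqP nz_b; apply: trans_t; exists b.
have [algz|trans_z] := classic (alg_mod phi z).
  exists B, phi; split=> // w; rewrite inE => /predU1P[->|] //; exact: algzs.
have cp : commr_rmorph phi z by move=> a; apply: mulrC.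
exists {poly B}, (horner_morph cp); split=> [b Mb|a|w].
- by apply: NNPP => /eqP nz_b; apply: trans_z; exists b.
- have [b <-] := iotaP a; exists b%:P; exact: horner_morphC.
rewrite inE => /predU1P[->|/algzs[F [nzF MF]]].
  (* The new variable maps to [z] itself, so [z] is a root of a monic linear polynomial. *)
  exists ('X - ('X)%:P); rewrite polyXsubC_eq0; split=> //.
  rewrite rmorphB /= map_polyX map_polyC /= hornerXsubC horner_morphX.
  by rewrite subrr; case: idM.
exists (map_poly polyC F); split.
  by rewrite -size_poly_gt0 size_map_inj_poly ?size_poly_gt0 //; apply: polyC_inj.
rewrite -map_poly_comp (eq_map_poly (g := phi)) // => b.
exact: horner_morphC.
Qed.

Section Span.
Variables (B : idomainType) (phi : {rmorphism B -> S}).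

Definition span_mod (I : finType) (es : I -> S) (s : S) : Prop :=
  exists b : I -> B, M (s - \sum_i phi (b i) * es i).

Lemma span_modD I es s t :
  @span_mod I es s -> span_mod es t -> span_mod es (s + t).
Proof.
case: idM => _ MD _ [b Mb] [c Mc]; exists (fun i => b i + c i).
have -> : \sum_i phi (b i + c i) * es i =
  \sum_i phi (b i) * es i + \sum_i phi (c i) * es i.
  by rewrite -big_split /=; apply: eq_bigr => i _; rewrite rmorphD mulrDl.
by rewrite opprD addrACA; apply: MD.
Qed.

Lemma span_modZ I es a s : @span_mod I es s -> span_mod es (phi a * s).
Proof.
case: idM => _ _ MM [b Mb]; exists (fun i => a * b i).
have -> : \sum_i phi (a * b i) * es i = phi a * \sum_i phi (b i) * es i.
  by rewrite mulr_sumr; apply: eq_bigr => i _; rewrite rmorphM mulrA.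
by rewrite -mulrBr; apply: MM.
Qed.

Lemma span_mod_congr I es s t : M (s - t) -> @span_mod I es t -> span_mod es s.
Proof.
case: idM => _ MD _ Mst [b Mb]; exists b; have := MD _ _ Mst Mb.
by rewrite addrA subrK.
Qed.

Lemma span_mod0 I es : @span_mod I es 0.
Proof.
case: idM => M0 _ _; exists (fun=> 0).
by rewrite big1 ?subr0 // => i _; rewrite rmorph0 mul0r.
Qed.

Lemma span_mod_sum I es (J : Type) (r : seq J) (P : pred J) (F : J -> S) :
  (forall j, P j -> @span_mod I es (F j)) -> span_mod es (\sum_(j <- r | P j) F j).
Proof.
move=> HF; elim/big_ind: _ => //; first exact: span_mod0.
by move=> s t; apply: span_modD.
Qed.

Lemma span_mod_gen (I : finType) (es : I -> S) i : span_mod es (es i).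
Proof.
case: idM => M0 _ _; exists (fun j => (j == i)%:R).
rewrite (bigD1 i) //= eqxx rmorph1 mul1r big1 ?addr0 ?subrr // => j /negPf->.
by rewrite rmorph0 mul0r.
Qed.

Lemma span_mod_mul (I : finType) (es : I -> S) (J : finType) (fs : J -> S) c s :
  (forall i, span_mod fs (c * es i)) -> span_mod es s -> span_mod fs (c * s).
Proof.
move=> Hc [b Mb]; have [_ _ MM] := idM.
apply: (span_mod_congr (t := c * \sum_i phi (b i) * es i)).
  by rewrite -mulrBr; apply: MM.
rewrite mulr_sumr; apply: span_mod_sum => i _.
by rewrite mulrCA; apply: span_modZ.
Qed.

(** Products of bounded powers of the generators span a finite module; the scalar [c], a product of
    leading coefficients, clears the denominators that appear when a high power is reduced. *)
Lemma alg_mod_span (zs : seq S) : {in zs, forall z, alg_mod phi z} ->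
  exists (I : finType) (es : I -> S) (i0 : I) (c : B),
    [/\ c != 0, es i0 = 1 & {in zs, forall z i, span_mod es (phi c * z * es i)}].
Proof.
elim: zs => [|z zs IHzs] algzs.
  by exists unit, (fun=> 1), tt, 1; rewrite oner_eq0.
have [|I [es [i0 [c [nzc es0 span_zs]]]]] := IHzs.
  by move=> w zs_w; apply: algzs; rewrite inE zs_w orbT.
have [F [nzF MF]] : alg_mod phi z by apply: algzs; rewrite inE eqxx.
have [n size_F] : exists n, size F = n.+1.
  by exists (size F).-1; rewrite prednK // size_poly_gt0.
(* Exponents run up to the degree [n] inclusive, so that exponent 0 exists even for [n = 0]; the
   overflowing power is reduced by [z] times the equation of [z]. *)
pose gs (ji : 'I_n.+1 * I) := z ^+ ji.1 * es ji.2.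
have gsP j i (ltj : (j < n.+1)%N) : span_mod gs (z ^+ j * es i).
  exact: (span_mod_gen gs (Ordinal ltj, i)).
exists ('I_n.+1 * I)%type, gs, (ord0, i0), (c * F`_n); split.
- by rewrite mulf_neq0 //; have := nzF; rewrite -lead_coef_eq0 /lead_coef size_F.
- by rewrite /gs /= es0 expr0 mulr1.
move=> w; rewrite inE => /predU1P[-> [j i] | zs_w [j i]]; rewrite rmorphM /gs /=.
  rewrite -mulrA -mulrA; apply: span_modZ.
  have [ltj|] := ltnP j.+1 n.+1.
    by apply: span_modZ; rewrite mulrA -exprS; apply: gsP.
  rewrite ltnS => lenj; have -> : (j : nat) = n by apply/eqP; rewrite eqn_leq -ltnS ltn_ord.
  have [_ _ MM] := idM.
  apply: (span_mod_congr (t := - \sum_(l < n) phi F`_l * (z ^+ l.+1 * es i))); last first.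
    rewrite -sumrN; apply: span_mod_sum => l _; rewrite -mulNr -rmorphN.
    by apply: span_modZ; apply: gsP; rewrite ltnS.
  have -> : phi F`_n * (z * (z ^+ n * es i)) + - - \sum_(l < n) phi F`_l * (z ^+ l.+1 * es i) =
      z * es i * (map_poly phi F).[z].
    rewrite (horner_coef_wide (n := n.+1)); last by rewrite -size_F size_poly.
    rewrite big_ord_recr /= mulrDr mulr_sumr opprK addrC coef_map /=; congr (_ + _); last by ring.
    by apply: eq_bigr => l _; rewrite coef_map /= exprS; ring.
  exact: MM.
have -> : phi c * phi F`_n * w * (z ^+ j * es i) =
  phi F`_n * (z ^+ j * (phi c * w * es i)) by ring.
apply: span_modZ; apply: (span_mod_mul (es := es)); last exact: span_zs.
by move=> l; apply: gsP.
Qed.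

(* If 1/g were in the span of es over B[1/c], then by Cayley-Hamilton g would
   divide a power of c. *)
Lemma span_mod_inv (I : finType) (es : I -> S) (i0 : I) (a g : B) (s : S) :
  inj_mod phi -> es i0 = 1 -> M (phi g * s - 1) ->
  (forall i, span_mod es (phi a * s * es i)) -> exists r h, a ^+ r = g * h.
Proof.
move=> inj_phi es0 Mgs span_s; have [M0 MD MM] := idM.
have /fin_all_exists[b Mb] : forall i, exists b : {ffun I -> B},
    M (phi a * es i - phi g * \sum_j phi (b j) * es j).
  move=> i; have [b Mb] := span_s i; exists [ffun j => b j].
  under eq_bigr do rewrite ffunE.
  have -> : phi a * es i - phi g * (\sum_j phi (b j) * es j) =
    phi g * (phi a * s * es i - \sum_j phi (b j) * es j) +
      (- (phi a * es i)) * (phi g * s - 1) by ring.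
  by apply: MD; apply: MM.
pose A : 'M[B]_(#|I|) := \matrix_(i, j) b (enum_val i) (enum_val j).
pose D := map_mx phi (a%:M - g *: A).
pose e : 'cV[S]_(#|I|) := \col_i es (enum_val i).
have MDe i : M ((D *m e) i 0).
  have := Mb (enum_val i); congr M; rewrite !mxE.
  have -> : \sum_j phi (b (enum_val i) j) * es j =
      \sum_j phi (A i j) * e j 0.
    rewrite (reindex (@enum_val I xpredT)) /=; last first.
      by exists enum_rank => x _; rewrite ?enum_valK ?enum_rankK.
    by apply: eq_big => [j|j _]; rewrite ?mxE.
  rewrite mulr_sumr; under [RHS]eq_bigr do rewrite !mxE rmorphB rmorphM mulrBl.
  rewrite sumrB; congr (_ - _); last by apply: eq_bigr => j _; rewrite ?mxE mulrA.
  rewrite (bigD1 i) //= !eqxx mulr1n big1 ?addr0 // => j /negPf ne_ji.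
  by rewrite eq_sym ne_ji mulr0n rmorph0 mul0r.
have : M (\det D).
  (* The entry of the vector at [i0] is 1, so the adjugate isolates [\det D] itself. *)
  have : M ((\adj D *m (D *m e)) (enum_rank i0) 0).
    by rewrite mxE; elim/big_ind: _ => // j _; apply: MM.
  by rewrite mulmxA mul_adj_mx mul_scalar_mx !mxE enum_rankK es0 mulr1.
rewrite det_map_mx => /inj_phi.
have [h ->] := det_scalar_sub a g A => /eqP; rewrite addr_eq0 => /eqP def_a.
by exists #|I|, (- h); rewrite def_a mulrN.
Qed.

End Span.
End AlgebraicMod.

Section Zariski.
Variables (k : fieldType) (N : nat).
Local Notation S := {mpoly k[N]}.

Lemma maximal_ideal_inv (M : S -> Prop) p :
  is_maximal_ideal M -> ~ M p -> exists s, M (p * s - 1).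
Proof.
case=> idM M1 maxM Mp; apply: NNPP => noinv; apply: Mp.
apply: (maxM (ideal_adjoin M p)); first exact: ideal_adjoin_ideal.
- exact: ideal_adjoin_sub.
- case=> q [c [Mq def1]]; apply: noinv; exists c.
  rewrite mulrC (_ : c * p - 1 = - q); first exact: ideal_predN.
  by rewrite def1 opprD addrCA subrr addr0.
- by rewrite -[X in ideal_adjoin _ _ X]mul1r; apply: ideal_adjoin_gen.
Qed.

(** If [t] were transcendental, [S / M] would be algebraic over an embedded polynomial ring, and
    finite over it once a single element [c] is inverted. A polynomial coprime to [c] would then
    become invertible although it divides no power of [c]. *)
Lemma zariski (M : S -> Prop) (t : S) : is_maximal_ideal M ->
  exists P : {poly k}, P != 0 /\ M (map_poly (@mpolyC N k) P).[t].
Proof.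
move=> maxM; have [idM M1 _] := maxM; apply: NNPP => trans_t.
have [M0 _ _] := idM.
have [B [phi [inj_phi iotaP algX]]] :=
  transcendental_tower idM [seq 'X_i | i <- enum 'I_N] (trans_t : ~ alg_mod M (@mpolyC N k) t).
have [I [es [i0 [c [nzc es0 spanX]]]]] := alg_mod_span idM algX.
have spanS s : exists e, forall x, span_mod M phi es x -> span_mod M phi es (phi c ^+ e * s * x).
  elim/mpoly_ring_ind: s => [a|i|p q [e He] [f Hf]|p q [e He] [f Hf]].
  - exists 0%N => x Hx; have [b <-] := iotaP a; rewrite expr0 mul1r; exact: span_modZ.
  - exists 1%N => x; rewrite expr1; apply: span_mod_mul => // j; apply: spanX.
    by apply: map_f; rewrite mem_enum.
  - exists (e + f)%N => x Hx; rewrite exprD mulrDr mulrDl.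
    apply: span_modD => //.
      have -> : phi c ^+ e * phi c ^+ f * p * x = phi c ^+ f * (phi c ^+ e * p * x) by ring.
      by rewrite -rmorphXn; apply: span_modZ => //; apply: He.
    have -> : phi c ^+ e * phi c ^+ f * q * x = phi c ^+ e * (phi c ^+ f * q * x) by ring.
    by rewrite -rmorphXn; apply: span_modZ => //; apply: Hf.
  - exists (e + f)%N => x Hx; rewrite exprD.
    have -> : phi c ^+ e * phi c ^+ f * (p * q) * x =
      phi c ^+ e * p * (phi c ^+ f * q * x) by ring.
    by apply: He; apply: Hf.
(* Coprime to [c] and nonconstant by construction; its constant coefficient 1 keeps it nonzero
   modulo [M]. *)
pose g := 1 + 'X * c.
have [|s Mgs] := maximal_ideal_inv (p := phi g) maxM.
  move/inj_phi/(congr1 (horner^~ 0))/eqP.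
  by rewrite /g hornerD hornerM hornerX mul0r addr0 !hornerC oner_eq0.
have [e span_s] := spanS s.
have [|r [h def_cr]] := span_mod_inv (a := c ^+ e) idM inj_phi es0 Mgs.
  by move=> i; rewrite rmorphXn; apply: span_s; apply: span_mod_gen.
by apply: (@poly_pow_notdiv _ c h (e * r)) => //; rewrite exprM.
Qed.

End Zariski.

(** * Length of prime chains *)

Section PrimeChains.
Variables (k : fieldType) (N : nat).
Local Notation S := {mpoly k[N]}.

Definition free_mod (P : S -> Prop) (I : finType) (u : I -> S) : Prop :=
  forall c : I -> k, P (\sum_i c i *: u i) -> forall i, c i = 0.

(** In a relation modulo [P], reduction modulo [P'] kills all positive powers of [y], so the
    coefficients at [y ^+ 0] vanish; then [y], which is not in the prime [P], is cancelled and the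
    argument repeats. *)
Lemma free_mod_powers (P P' : S -> Prop) y (I : finType) (u : I -> S) D :
  is_prime_ideal P -> is_ideal P' -> (forall p, P p -> P' p) -> P' y -> ~ P y ->
  free_mod P' u -> free_mod P (fun ji : 'I_D * I => y ^+ ji.1 * u ji.2).
Proof.
move=> [idP _ primeP] idP' sPP' P'y nPy free_u.
have [P'0 P'D P'M] := idP'.
have main E (c : nat -> I -> k) :
    P (\sum_(j < E) y ^+ j * \sum_i c j i *: u i) -> forall j i, (j < E)%N -> c j i = 0.
  elim: E c => // E IHE c; rewrite big_ord_recl expr0 mul1r.
  under [X in P (_ + X)]eq_bigr do rewrite lift0 exprS -mulrA.
  rewrite -mulr_sumr; set G := \sum_(j < E) _ => Psum.
  have c0 i : c 0%N i = 0.
    apply: (free_u (c 0%N)); rewrite -[X in P' X](addrK (y * G)).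
    apply: (ideal_predB idP'); first exact: sPP'.
    exact: (ideal_predMr _ idP').
  have {}Psum : P G.
    move: Psum; rewrite big1 ?add0r => [/primeP[]//|i _].
    by rewrite c0 scale0r.
  by case=> [|j] i; rewrite // ltnS; apply: (IHE (fun j => c j.+1)).
move=> c Psum [j i].
pose c' j i := if insub j is Some j' then c (j', i) else 0.
have c'E (l : 'I_D) m : c' l m = c (l, m) by rewrite /c' valK.
rewrite -c'E; apply: main (ltn_ord j).
move: Psum; congr P; rewrite (eq_bigr (fun ji : 'I_D * I => y ^+ ji.1 * (c' ji.1 ji.2 *: u ji.2))).
  rewrite -(pair_bigA _ (fun (l : 'I_D) m => y ^+ l * (c' l m *: u m))) /=.
  by apply: eq_bigr => l _; rewrite mulr_sumr.
by move=> [l m] _ /=; rewrite c'E scalerAr.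
Qed.

(** The family is linearly independent inside the span of the monomials with all exponents below
    [K]. *)
Lemma free_mod_card (P : S -> Prop) (I : finType) (u : I -> S) K :
  P 0 -> free_mod P u -> (forall i, msize (u i) <= K)%N -> (#|I| <= K ^ N)%N.
Proof.
move=> P0 free_u size_u; pose F := {ffun 'I_N -> 'I_K}.
have cardF : #|F| = (K ^ N)%N by rewrite card_ffun !card_ord.
pose mon (f : F) : 'X_{1..N} := [multinom (f i : nat) | i < N].
pose W : 'M[k]_(#|I|, #|F|) := \matrix_(i, f) (u (enum_val i))@_(mon (enum_val f)).
suff: row_free W by rewrite -cardF => /eqP <-; apply: rank_leq_col.
apply: inj_row_free => v vW0; apply/rowP => i; rewrite mxE -[i]enum_valK.
apply: (free_u (fun x => v 0 (enum_rank x))).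
suff -> : \sum_x v 0 (enum_rank x) *: u x = 0 by [].
apply/mpolyP => m; rewrite mcoeff0 raddf_sum /=.
have [ltm|] := ltnP (mdeg m) K; last first.
  move=> leK; apply: big1 => x _; rewrite mcoeffZ memN_msupp_eq0 ?mulr0 //.
  by apply: msize_mdeg_ge; apply: leq_trans leK.
have ltmi j : (m j < K)%N.
  by apply: leq_ltn_trans ltm; rewrite mdegE (bigD1 j) //= leq_addr.
pose f : F := [ffun j => Ordinal (ltmi j)].
have monf : mon f = m by apply/mnmP => j; rewrite mnmE ffunE.
have := congr1 (fun A : 'rV_(_) => A 0 (enum_rank f)) vW0; rewrite !mxE => vW0f.
rewrite -[RHS]vW0f.
rewrite (reindex (@enum_val I xpredT)) /=; last first.
  by exists enum_rank => x _; rewrite ?enum_valK ?enum_rankK.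
by apply: eq_big => [x|x _] //; rewrite mcoeffZ mxE enum_valK enum_rankK monf.
Qed.

Lemma msize_mul_le (p q : S) : (msize (p * q) <= (msize p + msize q).-1)%N.
Proof.
have [->|nz_p] := eqVneq p 0; first by rewrite mul0r msize0.
have [->|nz_q] := eqVneq q 0; first by rewrite mulr0 msize0.
by rewrite msizeM.
Qed.

(** A substitute for the Hilbert function: a chain of length [r] forces growth of order [D ^ r] in
    degrees linear in [D]. Each inclusion contributes the powers of one element of the larger prime
    outside the smaller one. *)
Lemma prime_chain_free (Q : nat -> S -> Prop) r :
  (forall i, (i <= r)%N -> is_prime_ideal (Q i)) ->
  (forall i, (i < r)%N -> (forall p, Q i p -> Q i.+1 p) /\ exists p, Q i.+1 p /\ ~ Q i p) ->
  exists delta, forall D, exists (I : finType) (u : I -> S),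
    [/\ #|I| = (D ^ r)%N, forall i, (msize (u i) <= D * delta + 1)%N & free_mod (Q 0%N) u].
Proof.
elim: r Q => [|r IHr] Q primeQ ltQ.
  exists 0%N => D; exists unit, (fun=> 1); rewrite card_unit muln0 msize1; split=> // c.
  case: (primeQ 0%N) => // -[_ _ QM] nQ1 _; rewrite (big_pred1 tt) => [Qc []|[]//].
  apply/eqP; apply: contra_notT nQ1 => nz_c.
  by rewrite -(scale1r 1) -(mulVf nz_c) -scalerA -mul_mpolyC; apply: QM.
have [i lei|i lti|delta IH] := IHr (fun i => Q i.+1); [exact: primeQ | exact: ltQ |].
have [sQ [y [Q1y nQ0y]]] := ltQ 0%N isT.
exists (delta + msize y)%N => D; have [I [u [cardI size_u free_u]]] := IH D.
exists ('I_D * I)%type, (fun ji : 'I_D * I => y ^+ ji.1 * u ji.2); split.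
- by rewrite card_prod card_ord cardI expnS.
- case=> j i /=; have le_yj : (msize (y ^+ j) <= j * msize y + 1)%N.
    elim: (j : nat) => [|e IHe]; first by rewrite expr0 msize1.
    rewrite exprS; apply: leq_trans (msize_mul_le _ _) _.
    by move: IHe; rewrite mulSn; lia.
  apply: leq_trans (msize_mul_le _ _) _; have := size_u i; have := ltn_ord j.
  by rewrite mulnDr; move: le_yj; nia.
- apply: free_mod_powers free_u => //; first exact: primeQ.
  by case: (primeQ 1%N).
Qed.

Lemma prime_chain_le (Q : nat -> S -> Prop) r :
  (forall i, (i <= r)%N -> is_prime_ideal (Q i)) ->
  (forall i, (i < r)%N -> (forall p, Q i p -> Q i.+1 p) /\ exists p, Q i.+1 p /\ ~ Q i p) ->
  (r <= N)%N.
Proof.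
move=> primeQ ltQ; have [delta Hdelta] := prime_chain_free primeQ ltQ.
rewrite leqNgt; apply/negP => ltNr.
(* Large enough that [D ^ N.+1] exceeds [(D * (delta + 1)) ^ N], the number of monomials
   available. *)
pose D := ((delta + 1) ^ N).+1; have [I [u [cardI size_u free_u]]] := Hdelta D.
have Q0 : Q 0%N 0 by case: (primeQ 0%N) => // -[].
have := free_mod_card Q0 free_u size_u; rewrite cardI leqNgt => /negP[].
apply: (@leq_ltn_trans ((D * (delta + 1)) ^ N)).
  have leX x y e : (x <= y)%N -> (x ^ e <= y ^ e)%N by case: e => // e; rewrite leq_exp2r.
  by apply: leX; rewrite mulnDr muln1 leq_add2l.
apply: (@leq_trans (D ^ N.+1)); last by rewrite leq_pexp2l.
by rewrite expnMn expnSr ltn_pmul2l ?expn_gt0.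
Qed.

Lemma prime_ideal_inter (I : finType) (J : I -> S -> Prop) (P : S -> Prop) :
  is_prime_ideal P -> (forall i, is_ideal (J i)) ->
  (forall p, (forall i, J i p) -> P p) -> exists i, forall p, J i p -> P p.
Proof.
move=> [idP nP1 primeP] idJ sJP; apply: NNPP => nsub.
have /fin_all_exists[f Hf] : forall i, exists p, J i p /\ ~ P p.
  move=> i; apply: NNPP => nJP; apply: nsub; exists i => p Jp.
  by apply: NNPP => nPp; apply: nJP; exists p.
have : P (\prod_i f i).
  apply: sJP => i; rewrite (bigD1 i) //=.
  by apply: (ideal_predMr _ (idJ i)); case: (Hf i).
elim/big_rec: _ => // i x _ IH /primeP[]; last exact: IH.
by case: (Hf i).
Qed.

(** The chain is prolonged downwards by the zero ideal and by the ideal of a single form of [B];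
    rank at least 2 makes the second inclusion strict. *)
Lemma prime_chain_lin_le (P : nat -> S -> Prop) d r (B : 'M[k]_(r, N)) :
  (forall i, (i <= d)%N -> is_prime_ideal (P i)) ->
  (forall i, (i < d)%N -> (forall p, P i p -> P i.+1 p) /\ exists p, P i.+1 p /\ ~ P i p) ->
  (1 < \rank B)%N -> (forall p, lin_ideal B p -> P 0%N p) -> (d.+2 <= N)%N.
Proof.
move=> primeP ltP rB sBP.
have nzB : B != 0 by rewrite -mxrank_eq0 -lt0n ltnW.
have nz_v := nz_row_eq0 B; rewrite (negPf nzB) in nz_v.
set v := nz_row B in nz_v.
have vB : (v <= B)%MS by apply: nz_row_sub.
have /row_subPn[i nBv] : ~~ (B <= v)%MS.
  by apply: contraL rB => /mxrankS/leq_trans le; rewrite -leqNgt le // rank_leq_row.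
pose Q j := match j with
  | 0 => lin_ideal (0 : 'rV[k]_N) | 1 => lin_ideal v | j'.+2 => P j' end.
apply: (@prime_chain_le Q) => [[|[|j]]|[|[|j]]] ltj //=; try exact: lin_ideal_prime.
- exact: primeP.
- split=> [p|]; first exact/lin_idealS/sub0mx.
  exists (linform v); split; first exact: lin_ideal_linform.
  by move/lin_ideal_linformE/submx0null/eqP; rewrite nz_v.
- split=> [p|]; first by move=> /(lin_idealS vB)/sBP.
  exists (linform (row i B)); split; first by apply/sBP/lin_ideal_linform/row_sub.
  by move/lin_ideal_linformE; rewrite (negPf nBv).
- exact: ltP.
Qed.

End PrimeChains.

(** * Regularity in a coordinate direction *)

Section ExtendedIdeals.
Variables (k : fieldType) (N : nat).
Local Notation S := {mpoly k[N]}.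
Implicit Types (J : S -> Prop) (P : {poly k}).

Definition poly_at P (t : S) : S := (map_poly (@mpolyC N k) P).[t].

(** Descending induction on [d]: in degree [d + e], with [e] the degree of [P], every other term
    involves a coefficient of [p] of index above [d], and the leading coefficient of [P] is a
    unit. *)
Lemma ideal_coef_quot J P (p : {poly S}) : ideal_pred J -> P != 0 ->
  (forall d, J (p * map_poly (@mpolyC N k) P)`_d) -> forall d, J p`_d.
Proof.
move=> idJ nzP JpP; have [J0 JD JM] := idJ.
suff main n d : (size p - n <= d)%N -> J p`_d.
  by move=> d; apply: (main (size p)); rewrite subnn.
elim: n d => [|n IHn] d led; first by rewrite nth_default // -[size p]subn0.
have [|] := leqP (size p - n)%N d; [exact: IHn | move=> ltd].
have [e sizeP] : exists e, size P = e.+1.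
  by exists (size P).-1; rewrite prednK // size_poly_gt0.
have nzl : P`_e != 0 by have := nzP; rewrite -lead_coef_eq0 /lead_coef sizeP.
have : J (p`_d * (P`_e)%:MP).
  have := JpP (d + e)%N; rewrite coefM.
  have ltde : (d < (d + e).+1)%N by rewrite ltnS leq_addr.
  rewrite (bigD1 (Ordinal ltde)) //= addKn coef_map /=; set X := (X in _ + X).
  move=> JpX; rewrite -[_ * _](addrK X); apply: ideal_predB => //.
  apply: (big_ind J) => // -[j ltj] /= /negP ne_jd; rewrite coef_map /=.
  have [ltdj|lejd] := ltnP d j.
    by apply: (ideal_predMr _ idJ); apply: IHn; lia.
  rewrite (nth_default 0 (n := d + e - j)) ?mpolyC0 ?mulr0 // sizeP.
  have : j <> d by move=> eq_jd; apply: ne_jd; apply/eqP/val_inj.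
  by move: lejd; lia.
move/(JM (P`_e)^-1%:MP); rewrite mulrCA -mpolyCM mulVf //.
by rewrite mpolyC1 mulr1.
Qed.

Section Direction.
Variables (t : 'rV[k]_N) (l : 'cV[k]_N).
Hypothesis tl1 : t *m l = 1%:M.

(** Expansion in powers of the form [t], for which ['X] stands, along the splitting of a form [v]
    into [v *m (1%:M - l *m t)], killed by [l], and a multiple of [t]. *)
Definition coord_expand : S -> {poly S} :=
  mmap (polyC \o @mpolyC N k)
    (fun i => (linform (row i (1%:M - l *m t)))%:P + ((l i 0)%:MP)%:P * 'X).

HB.instance Definition _ := GRing.RMorphism.on coord_expand.

Lemma coord_expandC c : coord_expand c%:MP = c%:MP%:P.
Proof. exact: mmapC. Qed.

Lemma coord_expand_linform v :
  coord_expand (linform v) =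
    (linform (v *m (1%:M - l *m t)))%:P + (((v *m l) 0 0)%:MP)%:P * 'X.
Proof.
rewrite /coord_expand rmorph_linform mulmx_sum_row linear_sum /= rmorph_sum /=.
rewrite [(v *m l) 0 0]mxE rmorph_sum /= rmorph_sum mulr_suml -big_split /=.
apply: eq_bigr => i _; rewrite linearZ /= -mul_mpolyC polyCM mulrDr mpolyCM polyCM.
by rewrite mulrA.
Qed.

Lemma coord_expand_fixed v : v *m l = 0 -> coord_expand (linform v) = (linform v)%:P.
Proof.
move=> vl0; rewrite coord_expand_linform vl0 mxE mpolyC0 mul0r addr0.
by rewrite mulmxBr mulmx1 mulmxA vl0 mul0mx subr0.
Qed.

Lemma coord_expand_dir : coord_expand (linform t) = 'X.
Proof.
rewrite coord_expand_linform mulmxBr mulmx1 mulmxA tl1 mul1mx subrr linear0.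
by rewrite mxE mulr1n mpolyC1 mul1r add0r.
Qed.

Lemma coord_expandK p : (coord_expand p).[linform t] = p.
Proof.
elim/mpoly_ring_ind: p => [c|i|p q IHp IHq|p q IHp IHq].
- by rewrite coord_expandC hornerC.
- rewrite -linform_delta coord_expand_linform hornerD hornerM hornerX !hornerC.
  rewrite mul_mpolyC -linearZ -linearD /= mulmxBr mulmx1 mulmxA.
  by rewrite {1}[_ *m l]mx11_scalar mul_scalar_mx subrK.
- rewrite rmorphD hornerD; exact: (congr2 (fun x y : S => x + y) IHp IHq).
- rewrite rmorphM hornerM; exact: (congr2 (fun x y : S => x * y) IHp IHq).
Qed.

Lemma coord_expand_at P x :
  coord_expand (poly_at P x) = (map_poly (polyC \o @mpolyC N k) P).[coord_expand x].
Proof.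
rewrite /poly_at -horner_map -map_poly_comp; congr (_.[_]).
by apply: eq_map_poly => c /=; rewrite coord_expandC.
Qed.

(** Equivalently, the ideal is generated by elements that do not involve the coordinate [t]. *)
Definition coef_closed J : Prop := forall p, J p -> forall d, J (coord_expand p)`_d.

Lemma coef_closed_lin_ideal r (B : 'M[k]_(r, N)) : B *m l = 0 -> coef_closed (lin_ideal B).
Proof.
move=> Bl0 p [s [sB ->]] d; have [J0 JD JM] := lin_ideal_ideal B.
rewrite rmorph_sum coef_sum /= big_seq; apply: (big_ind (lin_ideal B)) => //.
move=> x s_x; have /submxP[D def_x] := allP sB x s_x.
rewrite rmorphM /= coord_expand_fixed ?coefMC; last by rewrite def_x -mulmxA Bl0 mulmx0.
by apply: lin_ideal_mul; apply: (allP sB).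
Qed.

Lemma coef_closed_adjoin J g : coord_expand g = g%:P -> coef_closed J ->
  coef_closed (ideal_adjoin J g).
Proof.
move=> fix_g clJ _ [q [c [Jq ->]]] d; rewrite rmorphD rmorphM /= fix_g coefD coefMC.
by exists (coord_expand q)`_d, (coord_expand c)`_d; split=> //; apply: clJ.
Qed.

Lemma poly_at_fixed P v : v *m l = 0 ->
  coord_expand (poly_at P (linform v)) = (poly_at P (linform v))%:P.
Proof.
by move=> vl0; rewrite coord_expand_at coord_expand_fixed // map_poly_comp horner_map.
Qed.

(** Modulo such an ideal [t] is a free variable, and a nonzero polynomial in it with coefficients in
    the field is not a zero divisor. *)
Lemma poly_at_regular J P : ideal_pred J -> coef_closed J -> P != 0 ->
  forall h, J (h * poly_at P (linform t)) -> J h.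
Proof.
move=> idJ clJ nzP h /clJ Jh; have [J0 JD JM] := idJ.
have coefJ : forall d, J (coord_expand h)`_d.
  apply: (ideal_coef_quot idJ nzP) => d; have := Jh d; congr (J _`__).
  rewrite rmorphM /= coord_expand_at coord_expand_dir map_poly_comp.
  by rewrite -[_.['X]]/(_ \Po 'X) comp_polyXr.
rewrite -(coord_expandK h) horner_coef; apply: (big_ind J) => // i _.
rewrite mulrC; apply: JM; exact: coefJ.
Qed.

End Direction.

(** The columns of [L] are directions dual to the rows of [T], so each adjoined element is constant
    along the directions still to come and preserves [coef_closed] there. *)
Lemma weakly_regular_poly_at e (T : 'M[k]_(e, N)) (L : 'M[k]_(N, e)) (P : 'I_e -> {poly k})
    J (js : seq 'I_e) :
  T *m L = 1%:M -> ideal_pred J -> (forall i, P i != 0) -> uniq js ->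
  {in js, forall i, coef_closed (row i T) (col i L) J} ->
  weakly_regular J [seq poly_at (P i) (linform (row i T)) | i <- js].
Proof.
move=> TL1 idJ nzP; elim: js J idJ => //= j js IHjs J idJ /andP[js'j uniq_js] clJ.
have TLE i i' : row i T *m col i' L = (i == i')%:R%:M.
  rewrite -row_mul colE mulmxA TL1 mul1mx; apply/matrixP => x y.
  by rewrite !ord1 !mxE eqxx andbT mulr1n.
split.
  apply: poly_at_regular => //; last by apply: clJ; rewrite inE eqxx.
  by rewrite TLE eqxx.
apply: IHjs => //; first exact: ideal_adjoin_ideal.
move=> i js_i; apply: coef_closed_adjoin; last by apply: clJ; rewrite inE js_i orbT.
apply: poly_at_fixed; rewrite TLE; case: eqP => [eq_ji|_]; last by rewrite raddf0.
by rewrite eq_ji js_i in js'j.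
Qed.

End ExtendedIdeals.

(** * Grids of lines on a quadric *)

Section Rulings.
Variables (k : fieldType) (N : nat).
Implicit Types (u v x y z w : 'rV[k]_N) (U V L : 'M[k]_N)
  (l m : nat -> 'M[k]_N).

Lemma sub_span2P u1 u2 v :
  reflect (exists a b, v = a *: u1 + b *: u2) (v <= u1 + u2)%MS.
Proof.
apply: (iffP sub_addsmxP) => [[[c1 c2] /= ->]|[a [b ->]]].
  by exists (c1 0 0), (c2 0 0); rewrite [c1]mx11_scalar [c2]mx11_scalar !mul_scalar_mx !mxE.
by exists (a%:M, b%:M); rewrite /= !mul_scalar_mx.
Qed.

Lemma skew_eq0 U V v : (U :&: V)%MS = 0 -> (v <= U)%MS -> (v <= V)%MS -> v = 0.
Proof. by move=> UV0 vU vV; apply/eqP; rewrite -submx0 -UV0 sub_capmx vU vV. Qed.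

Lemma skewP U V : (forall v, (v <= U)%MS -> (v <= V)%MS -> v = 0) -> (U :&: V)%MS = 0.
Proof.
move=> H; apply/eqP/rowV0P => v; rewrite sub_capmx => /andP[]; exact: H.
Qed.

Lemma cap_pick U V : (U :&: V)%MS != 0 -> exists v, [/\ v != 0, (v <= U)%MS & (v <= V)%MS].
Proof.
case/rowV0Pn=> v; rewrite sub_capmx => /andP[vU vV] nzv; by exists v.
Qed.

Definition free2 u v : Prop := forall a b : k, a *: u + b *: v = 0 -> a = 0 /\ b = 0.

Lemma free2_neq0 u v : free2 u v -> u != 0 /\ v != 0.
Proof.
move=> fr; split; apply/eqP => e0.
  have /fr[/eqP] : 1 *: u + 0 *: v = 0 by rewrite e0 scaler0 scale0r addr0.
  by rewrite oner_eq0.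
have /fr[_ /eqP] : 0 *: u + 1 *: v = 0 by rewrite e0 scaler0 scale0r addr0.
by rewrite oner_eq0.
Qed.

Lemma free2_rank u v : free2 u v -> \rank (u + v)%MS = 2%N.
Proof.
move=> fr; have [nzu nzv] := free2_neq0 fr.
rewrite mxrank_disjoint_sum ?rank_rV ?nzu ?nzv //.
apply/eqP/rowV0P => c; rewrite sub_capmx => /andP[/sub_rVP[a ->] /sub_rVP[b ab]].
have [] := fr a (- b); first by rewrite ab scaleNr subrr.
by move=> ->; rewrite scale0r.
Qed.

Lemma rank2_span L u v : \rank L = 2%N -> (u <= L)%MS -> (v <= L)%MS -> free2 u v ->
  (L :=: u + v)%MS.
Proof.
move=> rL uL vL /free2_rank ruv; have suvL : (u + v <= L)%MS by rewrite addsmx_sub uL.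
by apply/eqmx_sym/eqmxP; rewrite -(mxrank_leqif_eq suvL) ruv rL.
Qed.

Lemma skew_free2 U V u v : (U :&: V)%MS = 0 -> (u <= U)%MS -> (v <= V)%MS ->
  u != 0 -> v != 0 -> free2 u v.
Proof.
move=> UV0 uU vV nzu nzv a b ab0.
have au0 : a *: u = 0.
  apply: (skew_eq0 UV0); first exact: scalemx_sub.
  by rewrite -(addrK (b *: v) (a *: u)) ab0 sub0r -scaleNr scalemx_sub.
move: ab0; rewrite au0 add0r => /eqP; rewrite scaler_eq0 (negPf nzv) orbF => /eqP->.
by move/eqP: au0; rewrite scaler_eq0 (negPf nzu) orbF => /eqP->.
Qed.

Lemma rank2_complete L u : \rank L = 2%N -> (u <= L)%MS -> u != 0 ->
  exists v, (v <= L)%MS /\ free2 u v.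
Proof.
move=> rL uL nzu; have /row_subPn[i nLu] : ~~ (L <= u)%MS.
  by apply/negP => /mxrankS; rewrite rL rank_rV nzu.
exists (row i L); split; first exact: row_sub.
move=> a b ab0; have b0 : b = 0.
  apply/eqP; apply: contraNT nLu => nzb; apply/sub_rVP; exists (- (b^-1 * a)).
  move/eqP: ab0; rewrite addrC addr_eq0 => /eqP/(congr1 (fun c => b^-1 *: c)).
  by rewrite scalerA mulVf // scale1r scalerN scalerA scaleNr.
split=> //; move/eqP: ab0; rewrite b0 scale0r addr0 scaler_eq0 (negPf nzu) orbF.
by move/eqP.
Qed.

Definition comb4 x y z w (a b c d : k) := a *: x + b *: y + c *: z + d *: w.

Definition free4 x y z w : Prop := forall a b c d : k,
  comb4 x y z w a b c d = 0 -> [/\ a = 0, b = 0, c = 0 & d = 0].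

Lemma comb4D x y z w a b c d a' b' c' d' :
  comb4 x y z w a b c d + comb4 x y z w a' b' c' d' =
  comb4 x y z w (a + a') (b + b') (c + c') (d + d').
Proof.
rewrite /comb4 !scalerDl addrACA; congr (_ + _).
by rewrite addrACA; congr (_ + _); rewrite addrACA.
Qed.

Lemma comb4Z x y z w e a b c d :
  e *: comb4 x y z w a b c d = comb4 x y z w (e * a) (e * b) (e * c) (e * d).
Proof. by rewrite /comb4 !scalerDr !scalerA. Qed.

Lemma comb4_inj x y z w a b c d a' b' c' d' : free4 x y z w ->
  comb4 x y z w a b c d = comb4 x y z w a' b' c' d' -> [/\ a = a', b = b', c = c' & d = d'].
Proof.
move=> fr /eqP; rewrite -subr_eq0 -scaleN1r comb4Z comb4D => /eqP/fr.
by rewrite !mulN1r => -[] /subr0_eq-> /subr0_eq-> /subr0_eq-> /subr0_eq->.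
Qed.

Lemma free4_skew U V x y z w : (U :&: V)%MS = 0 ->
  (x <= U)%MS -> (y <= U)%MS -> (z <= V)%MS -> (w <= V)%MS ->
  free2 x y -> free2 z w -> free4 x y z w.
Proof.
move=> UV0 xU yU zV wV fxy fzw a b c d; rewrite /comb4 -addrA => abcd0.
have ab0 : a *: x + b *: y = 0.
  apply: (skew_eq0 UV0); first by rewrite addmx_sub ?scalemx_sub.
  move/eqP: abcd0; rewrite addr_eq0 => /eqP->.
  by rewrite -scaleN1r scalemx_sub // addmx_sub ?scalemx_sub.
have [-> ->] := fxy _ _ ab0; move: abcd0; rewrite ab0 add0r.
by case/fzw=> -> ->.
Qed.

(** The 2-dimensional spaces are thought of as lines in the dual projective space. Indexing by [nat]
    with bounds makes a smaller grid a mere restriction of the same functions. *)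
Record grid (a b : nat) (l m : nat -> 'M[k]_N) : Prop := Grid {
  grid_rankl : forall i, (i < a)%N -> \rank (l i) = 2%N;
  grid_rankm : forall j, (j < b)%N -> \rank (m j) = 2%N;
  grid_skewl : forall i i', (i < a)%N -> (i' < a)%N -> i != i' -> (l i :&: l i')%MS = 0;
  grid_skewm : forall j j', (j < b)%N -> (j' < b)%N -> j != j' -> (m j :&: m j')%MS = 0;
  grid_meet : forall i j, (i < a)%N -> (j < b)%N -> \rank (l i :&: m j)%MS = 1%N }.

Lemma grid_sym a b l m : grid a b l m -> grid b a m l.
Proof.
by case=> rl rm sl sm me; split=> // i j lti ltj; rewrite capmxC; apply: me.
Qed.

(* The lines of the two rulings of the quadric x w = y z, in the space of linear forms. *)
Record ruled (a b : nat) (l m : nat -> 'M[k]_N) x y z w : Prop := Ruled {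
  ruled_free : free4 x y z w;
  ruled_m0 : (m 0%N :=: x + y)%MS;
  ruled_l : forall i, (i < a)%N -> exists s t, (s != 0) || (t != 0) /\
    (l i :=: comb4 x y z w s t 0 0 + comb4 x y z w 0 0 s t)%MS;
  ruled_m : forall j, (j < b)%N -> exists s t, (s != 0) || (t != 0) /\
    (m j :=: comb4 x y z w s 0 t 0 + comb4 x y z w 0 s 0 t)%MS }.

Lemma rank1_neq0 U : \rank U = 1%N -> U != 0.
Proof. by move=> rU; rewrite -mxrank_eq0 rU. Qed.

Lemma coef_eq0 U u v (c : k) : ~~ (v <= U)%MS -> (u <= U)%MS -> u + c *: v = 0 -> c = 0.
Proof.
move=> nvU uU /eqP; rewrite addrC addr_eq0 => /eqP cv; apply/eqP.
apply: contraNT nvU => nzc; rewrite -[v]scale1r -(mulVf nzc) -scalerA cv.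
by rewrite -scaleN1r !scalemx_sub.
Qed.

Lemma ruled11 l m : (3 < N)%N -> grid 1 1 l m -> exists x y z w, ruled 1 1 l m x y z w.
Proof.
move=> N4 [rl rm sl sm me].
have [x [nzx xl xm]] := cap_pick (rank1_neq0 (me 0%N 0%N isT isT)).
have [y [ym fxy]] := rank2_complete (rm 0%N isT) xm nzx.
have [z [zl fxz]] := rank2_complete (rl 0%N isT) xl nzx.
have m0 := rank2_span (rm 0%N isT) xm ym fxy.
have l0 := rank2_span (rl 0%N isT) xl zl fxz.
have nzm : ~~ (z <= m 0%N)%MS.
  apply/negP => zm; have := me 0%N 0%N isT isT.
  have /capmx_idPl-> : (l 0%N <= m 0%N)%MS by rewrite l0 addsmx_sub xm zm.
  by rewrite rl.
(* The two lines span only a 3-dimensional space; [3 < N] leaves room for a fourth independent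
   form. *)
have /row_subPn[i nw] : ~~ (1%:M <= m 0%N + z)%MS.
  rewrite sub1mx -col_leq_rank -ltnNge (leq_ltn_trans (mxrank_adds_leqif _ _)) //.
  by rewrite rm //; have := rank_leq_row z; lia.
set w := row i _ in nw.
exists x, y, z, w; split=> //.
- move=> a b c d; rewrite /comb4 => abcd0.
  have d0 : d = 0.
    apply: coef_eq0 nw _ abcd0; rewrite !addmx_sub ?scalemx_sub //.
    + by rewrite (submx_trans xm) ?addsmxSl.
    + by rewrite (submx_trans ym) ?addsmxSl.
    + exact: addsmxSr.
  move: abcd0; rewrite d0 scale0r addr0 => abc0.
  have c0 : c = 0 by apply: coef_eq0 nzm _ abc0; rewrite addmx_sub ?scalemx_sub.
  by move: abc0; rewrite c0 scale0r addr0 => /fxy[-> ->].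
- case=> // _; exists 1, 0; rewrite oner_eq0; split=> //.
  by rewrite /comb4 !scale0r !scale1r !addr0 !add0r.
- case=> // _; exists 1, 0; rewrite oner_eq0; split=> //.
  by rewrite /comb4 !scale0r !scale1r !addr0 !add0r.
Qed.

Lemma ruled12 l m : grid 1 2 l m -> exists x y z w, ruled 1 2 l m x y z w.
Proof.
move=> [rl rm sl sm me].
have [x [nzx xl xm]] := cap_pick (rank1_neq0 (me 0%N 0%N isT isT)).
have [z [nzz zl zm]] := cap_pick (rank1_neq0 (me 0%N 1%N isT isT)).
have [y [ym fxy]] := rank2_complete (rm 0%N isT) xm nzx.
have [w [wm fzw]] := rank2_complete (rm 1%N isT) zm nzz.
have m01 := sm 0%N 1%N isT isT isT.
have fxz := skew_free2 m01 xm zm nzx nzz.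
have m0 := rank2_span (rm 0%N isT) xm ym fxy.
have m1 := rank2_span (rm 1%N isT) zm wm fzw.
have l0 := rank2_span (rl 0%N isT) xl zl fxz.
exists x, y, z, w; split=> //; first exact: free4_skew m01 xm ym zm wm fxy fzw.
- case=> // _; exists 1, 0; rewrite oner_eq0; split=> //.
  by rewrite /comb4 !scale0r !scale1r !addr0 !add0r.
- case=> [|[|//]] _; [exists 1, 0 | exists 0, 1]; rewrite oner_eq0 ?orbT; split=> //.
    by rewrite /comb4 !scale0r !scale1r !addr0 !add0r.
  by rewrite /comb4 !scale0r !scale1r !addr0 !add0r.
Qed.

(** The vertices of the skew quadrilateral cut out by two lines of each family. *)
Definition corner l m x y z w : Prop :=
  [/\ free4 x y z w,
      (l 0%N :=: x + z)%MS, (l 1%N :=: y + w)%MS, (m 0%N :=: x + y)%MS & (m 1%N :=: z + w)%MS].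

Lemma grid_corner a b l m : (1 < a)%N -> (1 < b)%N -> grid a b l m ->
  exists x y z w, corner l m x y z w.
Proof.
move=> a2 b2 [rl rm sl sm me].
have [a1 b1] := (ltnW a2, ltnW b2).
have [x [nzx xl xm]] := cap_pick (rank1_neq0 (me 0%N 0%N a1 b1)).
have [z [nzz zl zm]] := cap_pick (rank1_neq0 (me 0%N 1%N a1 b2)).
have [y [nzy yl ym]] := cap_pick (rank1_neq0 (me 1%N 0%N a2 b1)).
have [w [nzw wl wm]] := cap_pick (rank1_neq0 (me 1%N 1%N a2 b2)).
have m01 := sm 0%N 1%N b1 b2 isT; have l01 := sl 0%N 1%N a1 a2 isT.
have fxz := skew_free2 m01 xm zm nzx nzz; have fyw := skew_free2 m01 ym wm nzy nzw.
have fxy := skew_free2 l01 xl yl nzx nzy; have fzw := skew_free2 l01 zl wl nzz nzw.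
exists x, y, z, w; split; first exact: free4_skew m01 xm ym zm wm fxy fzw.
- exact: rank2_span (rl _ a1) xl zl fxz.
- exact: rank2_span (rl _ a2) yl wl fyw.
- exact: rank2_span (rm _ b1) xm ym fxy.
- exact: rank2_span (rm _ b2) zm wm fzw.
Qed.

Lemma span2_scale u v (a b : k) : a != 0 -> b != 0 -> (a *: u + b *: v :=: u + v)%MS.
Proof. by move=> nza nzb; apply: adds_eqmx; apply: eqmx_scale. Qed.

Lemma corner_scale l m x y z w a b c d : a != 0 -> b != 0 -> c != 0 -> d != 0 ->
  corner l m x y z w -> corner l m (a *: x) (b *: y) (c *: z) (d *: w).
Proof.
move=> nza nzb nzc nzd [fr l0 l1 m0 m1]; split.
- move=> a' b' c' d'; rewrite /comb4 !scalerA => /fr[] /eqP.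
  rewrite mulf_eq0 (negPf nza) orbF => /eqP-> /eqP.
  rewrite mulf_eq0 (negPf nzb) orbF => /eqP-> /eqP.
  rewrite mulf_eq0 (negPf nzc) orbF => /eqP-> /eqP.
  by rewrite mulf_eq0 (negPf nzd) orbF => /eqP->.
- by apply: eqmx_trans l0 (eqmx_sym (span2_scale _ _ nza nzc)).
- by apply: eqmx_trans l1 (eqmx_sym (span2_scale _ _ nzb nzd)).
- by apply: eqmx_trans m0 (eqmx_sym (span2_scale _ _ nza nzb)).
- by apply: eqmx_trans m1 (eqmx_sym (span2_scale _ _ nzc nzd)).
Qed.

(** The third line meets [l 0] and [l 1] in points that are not vertices, because the lines [m] are
    skew; rescaling the vertices brings these points to [x + z] and [y + w]. *)
Lemma grid_corner3 a b l m : (1 < a)%N -> (2 < b)%N -> grid a b l m ->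
  exists x y z w, [/\ corner l m x y z w, ((x + z)%R <= m 2%N)%MS & ((y + w)%R <= m 2%N)%MS].
Proof.
move=> a2 b3 gr; have [a1 b2] := (ltnW a2, ltnW b3); have b1 := ltnW b2.
have [x [y [z [w cr]]]] := grid_corner a2 b2 gr; have [fr l0 l1 m0 m1] := cr.
have [rl rm sl sm me] := gr.
have key i u v : (i < a)%N -> (l i :=: u + v)%MS -> (u <= m 0%N)%MS -> (v <= m 1%N)%MS ->
    exists p q, [/\ p != 0, q != 0 & ((p *: u + q *: v)%R <= m 2%N)%MS].
  move=> lti li um vm; have [c [nzc]] := cap_pick (rank1_neq0 (me i 2%N lti b3)).
  rewrite li => /sub_span2P[p [q def_c]] cm; exists p, q; rewrite -def_c; split=> //.
    apply: contraNneq nzc => p0; apply/eqP; apply: (skew_eq0 (sm 1%N 2%N b2 b3 isT)) => //.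
    by rewrite def_c p0 scale0r add0r scalemx_sub.
  apply: contraNneq nzc => q0; apply/eqP; apply: (skew_eq0 (sm 0%N 2%N b1 b3 isT)) => //.
  by rewrite def_c q0 scale0r addr0 scalemx_sub.
have [p [q [nzp nzq pq]]] : exists p q, [/\ p != 0, q != 0 & ((p *: x + q *: z)%R <= m 2%N)%MS].
  by apply: (key 0%N); rewrite ?m0 ?m1 ?addsmxSl ?addsmxSr.
have [p' [q' [nzp' nzq' pq']]] :
    exists p q, [/\ p != 0, q != 0 & ((p *: y + q *: w)%R <= m 2%N)%MS].
  by apply: (key 1%N); rewrite ?m0 ?m1 ?addsmxSl ?addsmxSr.
exists (p *: x), (p' *: y), (q *: z), (q' *: w); split=> //; exact: corner_scale.
Qed.

Lemma pair_coef_eq0 (s t a : k) : (s != 0) || (t != 0) -> a * s = 0 -> a * t = 0 -> a = 0.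
Proof.
by case/orP=> [nz /eqP|nz _ /eqP]; rewrite mulf_eq0 (negPf nz) orbF => /eqP.
Qed.

Lemma free2_row x y z w s t : free4 x y z w -> (s != 0) || (t != 0) ->
  free2 (comb4 x y z w s t 0 0) (comb4 x y z w 0 0 s t).
Proof.
move=> fr nzst a b; rewrite !comb4Z comb4D !mulr0 !addr0 !add0r => /fr[as0 at0 bs0 bt0].
by split; [apply: pair_coef_eq0 as0 at0 | apply: pair_coef_eq0 bs0 bt0].
Qed.

Lemma free2_col x y z w s t : free4 x y z w -> (s != 0) || (t != 0) ->
  free2 (comb4 x y z w s 0 t 0) (comb4 x y z w 0 s 0 t).
Proof.
move=> fr nzst a b; rewrite !comb4Z comb4D !mulr0 !addr0 !add0r => /fr[as0 bs0 at0 bt0].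
by split; [apply: pair_coef_eq0 as0 at0 | apply: pair_coef_eq0 bs0 bt0].
Qed.

Lemma comb4E x y z w :
  [/\ comb4 x y z w 1 0 0 0 = x, comb4 x y z w 0 1 0 0 = y,
      comb4 x y z w 0 0 1 0 = z & comb4 x y z w 0 0 0 1 = w].
Proof. by rewrite /comb4 !scale0r !scale1r !addr0 !add0r. Qed.

Lemma ruled22 l m : grid 2 2 l m -> exists x y z w, ruled 2 2 l m x y z w.
Proof.
move=> gr; have [x [y [z [w [fr l0 l1 m0 m1]]]]] := @grid_corner 2 2 l m isT isT gr.
have [xE yE zE wE] := comb4E x y z w.
exists x, y, z, w; split=> //; case=> [|[|//]] _.
- by exists 1, 0; rewrite oner_eq0 xE zE.
- by exists 0, 1; rewrite oner_eq0 orbT yE wE.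
- by exists 1, 0; rewrite oner_eq0 xE yE.
- by exists 0, 1; rewrite oner_eq0 orbT zE wE.
Qed.

(** Three skew lines determine the quadric, and any line meeting all three belongs to the opposite
    ruling. This applies first to the [l i], which meet [m 0], [m 1], [m 2], then to each further
    [m j], for which three lines [l] are needed. *)
Lemma ruled_ge3 a b l m : (1 < a)%N -> (2 < b)%N -> (b <= 3)%N || (2 < a)%N ->
  grid a b l m -> exists x y z w, ruled a b l m x y z w.
Proof.
move=> a2 b3 ab3 gr; have [a1 b2] := (ltnW a2, ltnW b3); have b1 := ltnW b2.
have [x [y [z [w [[fr l0 l1 m0 m1] xzm ywm]]]]] := grid_corner3 a2 b3 gr.
have [rl rm sl sm me] := gr; have [xE yE zE wE] := comb4E x y z w.
have xz : comb4 x y z w 1 0 1 0 = x + z by rewrite /comb4 !scale0r !scale1r !addr0.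
have yw : comb4 x y z w 0 1 0 1 = y + w by rewrite /comb4 !scale0r !scale1r !addr0 add0r.
have nz10 : ((1 : k) != 0) || ((1 : k) != 0) by rewrite oner_eq0.
have m2 : (m 2%N :=: comb4 x y z w 1 0 1 0 + comb4 x y z w 0 1 0 1)%MS.
  by apply: rank2_span; [exact: rm | rewrite xz | rewrite yw | exact: free2_col].
have Pl i : (i < a)%N -> exists s t, (s != 0) || (t != 0) /\
    (l i :=: comb4 x y z w s t 0 0 + comb4 x y z w 0 0 s t)%MS.
  move=> lti; have [c1 [nz1 c1l c1m]] := cap_pick (rank1_neq0 (me i 0%N lti b1)).
  have [c2 [nz2 c2l c2m]] := cap_pick (rank1_neq0 (me i 1%N lti b2)).
  have [c3 [nz3 c3l c3m]] := cap_pick (rank1_neq0 (me i 2%N lti b3)).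
  have f12 := skew_free2 (sm 0%N 1%N b1 b2 isT) c1m c2m nz1 nz2.
  have li := rank2_span (rl i lti) c1l c2l f12.
  move: c1m; rewrite m0 => /sub_span2P[s [t def_c1]].
  move: c2m; rewrite m1 => /sub_span2P[s' [t' def_c2]].
  have {}def_c1 : c1 = comb4 x y z w s t 0 0 by rewrite /comb4 !scale0r !addr0.
  have {}def_c2 : c2 = comb4 x y z w 0 0 s' t' by rewrite /comb4 !scale0r !add0r.
  move: c3m; rewrite m2 => /sub_span2P[p [q def_c3]].
  move: (c3l); rewrite li => /sub_span2P[e [f def_c3']].
  have : comb4 x y z w p q p q = comb4 x y z w (e * s) (e * t) (f * s') (f * t').
    have := def_c3'; rewrite def_c3 def_c1 def_c2 !comb4Z !comb4D.
    by rewrite !mulr0 !mulr1 !addr0 !add0r.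
  case/(comb4_inj fr) => pE qE pE' qE'.
  have nzpq : (p != 0) || (q != 0).
    rewrite -negb_and; apply: contra nz3 => /andP[/eqP p0 /eqP q0].
    by rewrite def_c3 p0 q0 !scale0r addr0.
  exists p, q; split=> //; apply: rank2_span; [exact: rl | | | exact: free2_row].
    have -> : comb4 x y z w p q 0 0 = e *: c1 by rewrite def_c1 comb4Z -pE -qE mulr0.
    exact: scalemx_sub.
  have -> : comb4 x y z w 0 0 p q = f *: c2 by rewrite def_c2 comb4Z -pE' -qE' mulr0.
  exact: scalemx_sub.
exists x, y, z, w; split=> // j.
case: j => [_|[_|[_|j ltj]]].
- by exists 1, 0; rewrite oner_eq0 xE yE.
- by exists 0, 1; rewrite oner_eq0 orbT zE wE.
- by exists 1, 1; rewrite oner_eq0.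
have a3 : (2 < a)%N by move: ab3 ltj; lia.
move: j.+3 ltj => {}j ltj.
(* Skewness to [l 1] and [l 0] makes both parameters of [l 2] nonzero, which allows the divisions by
   [s] and [t] below. *)
have [s [t [nzst l2]]] := Pl 2%N a3.
have nzs : s != 0.
  apply: contraTneq nzst => s0; rewrite s0 eqxx /= negbK.
  have : comb4 x y z w 0 t 0 0 = 0.
    apply: (skew_eq0 (sl 1%N 2%N a2 a3 isT)); last by rewrite l2 s0 addsmxSl.
    by rewrite l1 /comb4 !scale0r !addr0 add0r scalemx_sub ?addsmxSl.
  by case/fr=> _ ->.
have nzt : t != 0.
  apply: contraTneq nzst => t0; rewrite t0 eqxx orbF negbK.
  have : comb4 x y z w s 0 0 0 = 0.
    apply: (skew_eq0 (sl 0%N 2%N a1 a3 isT)); last by rewrite l2 t0 addsmxSl.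
    by rewrite l0 /comb4 !scale0r !addr0 scalemx_sub ?addsmxSl.
  by case/fr=> ->.
have [c1 [nz1 c1l c1m]] := cap_pick (rank1_neq0 (me 0%N j a1 ltj)).
have [c2 [nz2 c2l c2m]] := cap_pick (rank1_neq0 (me 1%N j a2 ltj)).
have [c3 [nz3 c3l c3m]] := cap_pick (rank1_neq0 (me 2%N j a3 ltj)).
have f12 := skew_free2 (sl 0%N 1%N a1 a2 isT) c1l c2l nz1 nz2.
have mj := rank2_span (rm j ltj) c1m c2m f12.
move: c1l; rewrite l0 => /sub_span2P[p [q def_c1]].
move: c2l; rewrite l1 => /sub_span2P[p' [q' def_c2]].
have {}def_c1 : c1 = comb4 x y z w p 0 q 0 by rewrite /comb4 !scale0r !addr0.
have {}def_c2 : c2 = comb4 x y z w 0 p' 0 q' by rewrite /comb4 !scale0r addr0 add0r.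
move: c3l; rewrite l2 => /sub_span2P[e [f def_c3]].
move: (c3m); rewrite mj => /sub_span2P[g [h def_c3']].
have : comb4 x y z w (e * s) (e * t) (f * s) (f * t) =
       comb4 x y z w (g * p) (h * p') (g * q) (h * q').
  have := def_c3'; rewrite def_c3 def_c1 def_c2 !comb4Z !comb4D.
  by rewrite !mulr0 !addr0 !add0r.
case/(comb4_inj fr) => esE etE fsE ftE.
have nzef : (e != 0) || (f != 0).
  rewrite -negb_and; apply: contra nz3 => /andP[/eqP e0 /eqP f0].
  by rewrite def_c3 e0 f0 !scale0r addr0.
exists e, f; split=> //; apply: rank2_span; [exact: rm | | | exact: free2_col].
  have -> : comb4 x y z w e 0 f 0 = (s^-1 * g) *: c1.
    by rewrite def_c1 comb4Z -!mulrA -esE -fsE !mulr0 ![s^-1 * (_ * s)]mulrC !mulfK.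
  exact: scalemx_sub.
have -> : comb4 x y z w 0 e 0 f = (t^-1 * h) *: c2.
  by rewrite def_c2 comb4Z -!mulrA -etE -ftE !mulr0 ![t^-1 * (_ * t)]mulrC !mulfK.
exact: scalemx_sub.
Qed.

Lemma grid_ruled a b l m : (3 < N)%N -> (0 < a)%N -> (a <= b)%N ->
  (a = 1 -> b <= 2)%N -> (a = 2%N -> b <= 3)%N ->
  grid a b l m -> exists x y z w, ruled a b l m x y z w.
Proof.
move=> N4 a0 leab a1b a2b gr.
have [a2|] := ltnP 1 a; last first.
  move=> a_le1; have a1 : a = 1%N by lia.
  move: gr; rewrite a1; have := a1b a1; case: b leab {a1b a2b} => [|[|[|//]]] => [|_ _|_ _].
  - by rewrite a1.
  - exact: ruled11.
  - exact: ruled12.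
have [b3|b_le2] := ltnP 2 b.
  by apply: ruled_ge3 => //; case: (ltnP 2 a) => [_|a_le2]; rewrite ?orbT // a2b //; lia.
have eb : b = 2%N by lia.
by move: gr; rewrite eb (_ : a = 2%N); [exact: ruled22 | lia].
Qed.

End Rulings.

Lemma nat_choice (T : Type) (x0 : T) n (P : nat -> T -> Prop) :
  (forall i, (i < n)%N -> exists x, P i x) ->
  exists f : nat -> T, forall i, (i < n)%N -> P i (f i).
Proof.
move=> HP; have /fin_all_exists[f Hf] : forall i : 'I_n, exists x, P i x.
  by move=> i; apply: HP.
exists (fun i => if insub i is Some j then f j else x0) => i lti.
by rewrite insubT; apply: (Hf (Ordinal lti)).
Qed.

(** * A common complement to all lines of the grid *)

Section Transversal.
Variables (k : fieldType) (N : nat).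
Implicit Types (u v x y z w : 'rV[k]_N) (U V L : 'M[k]_N) (l m : nat -> 'M[k]_N).

(* r |-> r^2 - r identifies 0 and 1, so it is not onto a finite field. *)
Lemma artin_schreier_or_infinite :
  (exists c : k, forall r, r * r - r != c) \/ (forall s : seq k, exists r, r \notin s).
Proof.
have [nc|nc] := classic (exists c : k, forall r, r * r - r != c); [by left | right=> s].
apply: NNPP => full.
have fullS r : r \in undup s.
  by rewrite mem_undup; apply/negPn/negP => nr; apply: full; exists r.
pose f r : k := r * r - r; pose U := rem 1 (undup s).
have memU r : (r \in U) = (r != 1) by rewrite mem_rem_uniq ?undup_uniq // inE /= fullS andbT.
have : (size (undup s) <= size (map f U))%N.
  apply: uniq_leq_size (undup_uniq s) _ => c _.
  apply: NNPP => nim; apply: nc; exists c => r; apply/eqP => fr.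
  apply: nim; rewrite -fr -/(f r); have [->|nr1] := eqVneq r 1.
    have -> : f 1 = f 0 by rewrite /f mul0r mul1r !subrr.
    by apply: map_f; rewrite memU eq_sym oner_eq0.
  by apply: map_f; rewrite memU.
by rewrite size_map size_rem //; have := fullS 1; case: (undup s) => //= ? ? _; rewrite ltnn.
Qed.

Lemma seq_choice (n : nat) (P : nat -> k -> k -> Prop) :
  (forall i, (i < n)%N -> exists s t, P i s t) ->
  exists f : nat -> k * k, forall i, (i < n)%N -> P i (f i).1 (f i).2.
Proof.
move=> HP; apply: (@nat_choice _ (0, 0) n (fun i st => P i st.1 st.2)) => i lti.
by have [s [t Pst]] := HP i lti; exists (s, t).
Qed.

(** For the matrix C of the four scalars, the first condition says that the row (s, t) is not an
    eigenvector of C, the second that [\det (t - s C)] is nonzero, so that t/s is not an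
    eigenvalue. *)
Lemma transversal_matrix a b (e f : nat -> k * k) :
  (forall i, (i < a)%N -> ((e i).1 != 0) || ((e i).2 != 0)) ->
  (forall j, (j < b)%N -> ((f j).1 != 0) || ((f j).2 != 0)) ->
  exists c00 c01 c10 c11 : k,
    (forall i, (i < a)%N -> let: (s, t) := e i in
       (s * c00 + t * c10) * t - (s * c01 + t * c11) * s != 0) /\
    (forall j, (j < b)%N -> let: (s, t) := f j in
       (t - s * c00) * (t - s * c11) - s * s * c01 * c10 != 0).
Proof.
move=> nze nzf; case: artin_schreier_or_infinite => [[c Hc]|inf].
  (* The characteristic polynomial is T^2 - T - c, which has no root: there are neither eigenvalues
     nor eigenvectors. *)
  exists 0, 1, c, 1; split=> n ltn.
    have := nze n ltn; case: (e n) => s t /= nzst.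
    rewrite (_ : _ - _ = - (s * s + s * t - c * t * t)); last by ring.
    rewrite oppr_eq0; have [t0|nzt] := eqVneq t 0.
      by move: nzst; rewrite t0 eqxx orbF !mulr0 addr0 subr0 mulf_eq0 orbb.
    apply: contra_neq (Hc (- (s / t))) => eq0.
    apply: (mulfI nzt); apply: (mulfI nzt); apply/eqP; rewrite -subr_eq0.
    by rewrite -eq0; apply/eqP; field.
  have := nzf n ltn; case: (f n) => s t /= nzst.
  rewrite (_ : _ - _ = t * t - s * t - s * s * c); last by ring.
  have [s0|nzs] := eqVneq s 0.
    by move: nzst; rewrite s0 eqxx /= !mul0r !subr0 mulf_eq0 orbb.
  apply: contra_neq (Hc (t / s)) => eq0.
  apply: (mulfI nzs); apply: (mulfI nzs); apply/eqP; rewrite -subr_eq0.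
  by rewrite -eq0; apply/eqP; field.
have [r Hr] := inf [seq (e i).1 / (e i).2 | i <- iota 0 a].
have [q Hq] := inf [seq (f j).2 / (f j).1 | j <- iota 0 b].
(* A matrix with the double eigenvalue [q] and the single eigenline spanned by (r, 1); both
   parameters avoid finitely many ratios. Ratios with zero denominator are treated apart. *)
exists (q + r), 1, (- (r * r)), (q - r); split=> n ltn.
  have ne : r != (e n).1 / (e n).2.
    apply: contraNneq Hr => ->; apply/mapP; exists n; rewrite ?mem_iota //.
  have := nze n ltn; case: (e n) ne => s t /= ne nzst.
  rewrite (_ : _ - _ = - ((s - r * t) * (s - r * t))); last by ring.
  rewrite oppr_eq0 mulf_eq0 orbb subr_eq0; have [t0|nzt] := eqVneq t 0.
    by move: nzst; rewrite t0 eqxx orbF mulr0.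
  by apply: contra_neq ne => ->; rewrite mulfK.
have ne : q != (f n).2 / (f n).1.
  by apply: contraNneq Hq => ->; apply/mapP; exists n; rewrite ?mem_iota.
have := nzf n ltn; case: (f n) ne => s t /= ne nzst.
rewrite (_ : _ - _ = (t - q * s) * (t - q * s)); last by ring.
rewrite mulf_eq0 orbb subr_eq0; have [s0|nzs] := eqVneq s 0.
  by move: nzst; rewrite s0 eqxx /= mulr0.
by apply: contra_neq ne => ->; rewrite mulfK.
Qed.

Lemma comb4_sub x y z w p q r s : (comb4 x y z w p q r s <= x + y + z + w)%MS.
Proof.
rewrite /comb4 !addmx_sub ?scalemx_sub ?addsmxSr //.
- by rewrite -addsmxA -addsmxA addsmxSl.
- by rewrite -addsmxA (submx_trans _ (addsmxSl _ _)) ?addsmxSr.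
- by rewrite (submx_trans _ (addsmxSl _ _)) ?addsmxSr.
Qed.

Lemma ruled_sub a b l m x y z w : ruled a b l m x y z w ->
  (forall i, (i < a)%N -> (l i <= x + y + z + w)%MS) /\
  (forall j, (j < b)%N -> (m j <= x + y + z + w)%MS).
Proof.
case=> fr _ Hl Hm; split=> n ltn.
  by have [s [t [_ ->]]] := Hl n ltn; rewrite addsmx_sub !comb4_sub.
by have [s [t [_ ->]]] := Hm n ltn; rewrite addsmx_sub !comb4_sub.
Qed.

Lemma ruled_transversal a b l m x y z w : ruled a b l m x y z w ->
  exists t1 t2, [/\ free2 t1 t2, (t1 + t2 <= x + y + z + w)%MS,
    forall i, (i < a)%N -> (l i :&: (t1 + t2))%MS = 0
    & forall j, (j < b)%N -> (m j :&: (t1 + t2))%MS = 0].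
Proof.
case=> fr _ /seq_choice[e He] /seq_choice[f Hf].
have [i lti|j ltj|c00 [c01 [c10 [c11 [He' Hf']]]]] := @transversal_matrix a b e f.
- by case: (He i lti).
- by case: (Hf j ltj).
(* The graph of C as a map from the span of [x], [y] to the span of [z], [w]. *)
exists (comb4 x y z w 1 0 c00 c01), (comb4 x y z w 0 1 c10 c11); split.
- move=> p q; rewrite !comb4Z comb4D => /fr[].
  by rewrite !mulr0 !mulr1 add0r addr0.
- by rewrite addsmx_sub !comb4_sub.
- move=> i lti; have [nz li] := He i lti; have := He' i lti.
  case: (e i) nz li => s t /= nz li D; apply: skewP => v.
  rewrite li => /sub_span2P[p [q ->]] /sub_span2P[g [h]].
  rewrite !comb4Z !comb4D !mulr0 !mulr1 !addr0 !add0r.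
  case/(comb4_inj fr)=> ps pt qs qt.
  have p0 : p = 0.
    apply/eqP; apply: contraNT D => nzp; apply/eqP/(mulfI nzp); rewrite mulr0.
    have -> : p * ((s * c00 + t * c10) * t - (s * c01 + t * c11) * s) =
      (p * s * c00 + p * t * c10) * t - (p * s * c01 + p * t * c11) * s by ring.
    by rewrite ps pt -qs -qt; ring.
  have q0 : q = 0.
    apply: (pair_coef_eq0 nz); first by rewrite qs -ps -pt p0 !mul0r addr0.
    by rewrite qt -ps -pt p0 !mul0r addr0.
  by rewrite p0 q0 !mul0r /comb4 !scale0r !addr0.
- move=> j ltj; have [nz mj] := Hf j ltj; have := Hf' j ltj.
  case: (f j) nz mj => s t /= nz mj D; apply: skewP => v.
  rewrite mj => /sub_span2P[p [q ->]] /sub_span2P[g [h]].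
  rewrite !comb4Z !comb4D !mulr0 !mulr1 !addr0 !add0r.
  case/(comb4_inj fr)=> ps qs pt qt.
  have E1 : p * (t - s * c00) = q * (s * c10) by rewrite mulrBr pt -ps -qs; ring.
  have E2 : q * (t - s * c11) = p * (s * c01) by rewrite mulrBr qt -ps -qs; ring.
  have p0 : p = 0.
    apply/eqP; apply: contraNT D => nzp; apply/eqP/(mulfI nzp); rewrite mulr0.
    have -> : p * ((t - s * c00) * (t - s * c11) - s * s * c01 * c10) =
      (p * (t - s * c00)) * (t - s * c11) - (p * (s * c01)) * (s * c10) by ring.
    by rewrite E1 -E2; ring.
  have q0 : q = 0.
    apply/eqP; apply: contraNT D => nzq; apply/eqP/(mulfI nzq); rewrite mulr0.
    have -> : q * ((t - s * c00) * (t - s * c11) - s * s * c01 * c10) =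
      (q * (t - s * c11)) * (t - s * c00) - (q * (s * c10)) * (s * c01) by ring.
    by rewrite E2 -E1; ring.
  by rewrite p0 q0 !mul0r /comb4 !scale0r !addr0.
Qed.

Lemma free4_rank x y z w : free4 x y z w -> \rank (x + y + z + w)%MS = 4%N.
Proof.
move=> fr; have fxy : free2 x y.
  move=> a b ab0; have := fr a b 0 0; rewrite /comb4 !scale0r !addr0.
  by move=> /(_ ab0)[-> ->].
have fzw : free2 z w.
  move=> a b ab0; have := fr 0 0 a b; rewrite /comb4 !scale0r !add0r.
  by move=> /(_ ab0)[_ _ -> ->].
rewrite -addsmxA mxrank_disjoint_sum ?free2_rank //.
apply: skewP => v /sub_span2P[a [b ->]] /sub_span2P[c [d abcd]].
have [] := fr a b (- c) (- d); last by move=> -> -> _ _; rewrite !scale0r addr0.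
by rewrite /comb4 -addrA !scaleNr -opprD abcd subrr.
Qed.

Lemma ruled_complement a b l m x y z w : ruled a b l m x y z w ->
  exists T : 'M[k]_N, [/\ (\rank T).+2 = N,
    forall i, (i < a)%N -> (l i :&: T)%MS = 0 & forall j, (j < b)%N -> (m j :&: T)%MS = 0].
Proof.
move=> ru; have [sl sm] := ruled_sub ru.
have [t1 [t2 [ft st Hl Hm]]] := ruled_transversal ru.
set V := (x + y + z + w)%MS in st sl sm; have rV : \rank V = 4%N by apply/free4_rank/ruled_free/ru.
have VC0 : (V :&: V^C)%MS = 0 by apply: capmx_compl.
have cap0 L : (L <= V)%MS -> (L :&: (t1 + t2))%MS = 0 -> (L :&: (t1 + t2 + V^C))%MS = 0.
  move=> LV L0; apply: skewP => v vL /sub_addsmxP[[c1 c2] /= def_v].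
  have c2V : c2 *m V^C%MS = 0.
    apply: (skew_eq0 VC0); last exact: submxMl.
    have -> : c2 *m V^C%MS = v - c1 *m (t1 + t2)%MS by rewrite def_v addrAC subrr add0r.
    rewrite addmx_sub ?(submx_trans vL) // -scaleN1r scalemx_sub //.
    by rewrite (submx_trans _ st) ?submxMl.
  by apply: (skew_eq0 L0) => //; rewrite def_v c2V addr0 submxMl.
exists (t1 + t2 + V^C)%MS; split=> [|i lti|j ltj].
- rewrite mxrank_disjoint_sum ?(free2_rank ft) ?mxrank_compl ?rV; last first.
    apply: skewP => v vt vC; apply: (skew_eq0 VC0) => //; exact: submx_trans st.
  by have := rank_leq_col V; rewrite rV; lia.
- by apply: cap0; [exact: sl | exact: Hl].
- by apply: cap0; [exact: sm | exact: Hm].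
Qed.

End Transversal.

(** * Adding one plane at a time *)

Section RegularSeq.
Variables (k : fieldType) (N : nat).
Local Notation S := {mpoly k[N]}.
Implicit Types (J M : S -> Prop) (fs : seq S).

Lemma ideal_add_seqE J fs p : ideal_add_seq J fs p <-> ideal_adjoins J fs p.
Proof.
elim: fs J p => [|f fs IHfs] J p.
  split=> [[q [Jq [cs ->]]]|Jp]; first by rewrite big_ord0 addr0.
  by exists p; split=> //; exists [::]; rewrite big_ord0 addr0.
rewrite /ideal_adjoins /= -/(ideal_adjoins _ fs); split=> [[q [Jq [cs ->]]]|/IHfs].
  apply/IHfs; exists (q + cs`_0 * f); split; first by exists q, cs`_0.
  exists (behead cs); rewrite big_ord_recl /= addrA.
  by congr (_ + _); apply: eq_bigr => i _; rewrite nth_behead.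
case=> _ [[q [c [Jq ->]]] [cs ->]]; exists q; split=> //; exists (c :: cs).
by rewrite big_ord_recl addrA.
Qed.

Lemma weakly_regular_nth J fs : weakly_regular J fs <->
  (forall i, (i < size fs)%N -> forall g,
     ideal_adjoins J (take i fs) (g * fs`_i) -> ideal_adjoins J (take i fs) g).
Proof.
elim: fs J => [|f fs IHfs] J //=; split=> [[regf /IHfs regs] [|i] lti g|regs].
- exact: regf.
- exact: regs.
split=> [g|]; first exact: (regs 0%N).
by apply/IHfs => i lti g; apply: (regs i.+1).
Qed.

Lemma regular_seq_inE J M fs : is_ideal M -> ~ M 1 -> (forall p, J p -> M p) ->
  {in fs, forall f, M f} -> weakly_regular J fs -> regular_seq_in J M fs.
Proof.
move=> idM nM1 sJM Mfs /weakly_regular_nth reg; split.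
- by move=> i lti; apply: Mfs; apply: mem_nth.
- by move=> i lti g /ideal_add_seqE/(reg i lti)/ideal_add_seqE.
- by move/ideal_add_seqE/(ideal_adjoins_min idM sJM Mfs).
Qed.

Lemma regular_seq_in_weakly J M fs : regular_seq_in J M fs -> weakly_regular J fs.
Proof.
case=> _ reg _; apply/weakly_regular_nth => i lti g.
by move/ideal_add_seqE/(reg i lti)/ideal_add_seqE.
Qed.

Lemma weakly_regular_take J fs d : weakly_regular J fs -> weakly_regular J (take d fs).
Proof. by elim: fs J d => [|f fs IHfs] J [|d] //= [regf /IHfs]. Qed.

Lemma weakly_regular_full J fs : (forall p, J p) -> weakly_regular J fs.
Proof.
by elim: fs J => //= f fs IHfs J fullJ; split=> //; apply: IHfs => p; apply: ideal_adjoin_sub.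
Qed.

End RegularSeq.

Section AddingLines.
Variables (k : fieldType) (N : nat).
Local Notation S := {mpoly k[N]}.
Implicit Types (l m : nat -> 'M[k]_N).

Definition grid_ideal p q l m (h : S) : Prop :=
  (forall i, (i < p)%N -> lin_ideal (l i) h) /\ (forall j, (j < q)%N -> lin_ideal (m j) h).

Lemma grid_ideal_ideal p q l m : ideal_pred (grid_ideal p q l m).
Proof.
split.
- by split=> i _; [case: (lin_ideal_ideal (l i)) | case: (lin_ideal_ideal (m i))].
- move=> f g [fl fm] [gl gm]; split=> i lti.
    by case: (lin_ideal_ideal (l i)) => _ D _; apply: D; [apply: fl | apply: gl].
  by case: (lin_ideal_ideal (m i)) => _ D _; apply: D; [apply: fm | apply: gm].
- move=> r f [fl fm]; split=> i lti.
    by case: (lin_ideal_ideal (l i)) => _ _; apply; apply: fl.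
  by case: (lin_ideal_ideal (m i)) => _ _; apply; apply: fm.
Qed.

Lemma grid_sub p q p' q' l m : (p <= p')%N -> (q <= q')%N -> grid p' q' l m -> grid p q l m.
Proof.
move=> lep leq [rl rm sl sm me].
have ltp i : (i < p)%N -> (i < p')%N by move/leq_trans; apply.
have ltq i : (i < q)%N -> (i < q')%N by move/leq_trans; apply.
split=> [i /ltp|j /ltq|i i' /ltp lti /ltp|j j' /ltq ltj /ltq|i j /ltp lti /ltq].
- exact: rl.
- exact: rm.
- exact: sl.
- exact: sm.
- exact: me.
Qed.

(** The product of the [c j] is to vanish on every old plane but not on the new one [l p]. For
    [j < p] the common form of [l j] and [m j] serves both families at once. *)
Lemma grid_forms p q l m : grid p.+1 q l m -> exists c : nat -> 'rV[k]_N,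
  forall j, (j < q)%N ->
    [/\ (c j <= m j)%MS, ~~ (c j <= l p)%MS & (j < p)%N -> (c j <= l j)%MS].
Proof.
case=> rl rm sl sm me.
apply: (@nat_choice 'rV[k]_N 0 q (fun j c =>
  [/\ (c <= m j)%MS, ~~ (c <= l p)%MS & (j < p)%N -> (c <= l j)%MS])) => j ltj.
have [ltjp|lepj] := ltnP j p.
  have [c [nzc cl cm]] := cap_pick (rank1_neq0 (me j j (ltnW ltjp) ltj)).
  exists c; split=> //; apply: contra nzc => clp; apply/eqP.
  apply: (skew_eq0 (sl j p _ _ _)) => //; first exact: ltnW.
  by rewrite ltn_eqF.
have /row_subPn[i nci] : ~~ (m j <= l p)%MS.
  by apply/negP => /capmx_idPr ml; have := me p j (ltnSn p) ltj; rewrite ml rm.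
by exists (row i (m j)); split=> //; apply: row_sub.
Qed.

Section OneLine.
Variables (p q : nat) (l m : nat -> 'M[k]_N) (c : nat -> 'rV[k]_N).
Hypothesis gr : grid p.+1 q l m.
Hypothesis lepq : (p <= q)%N.
Hypothesis cP : forall j, (j < q)%N ->
  [/\ (c j <= m j)%MS, ~~ (c j <= l p)%MS & (j < p)%N -> (c j <= l j)%MS].

Let rank_ml j : (j < q)%N -> \rank (m j + l p)%MS = 3%N.
Proof.
case: gr => rl rm _ _ me ltj; have := mxrank_sum_cap (m j) (l p).
by rewrite capmxC me // rl // rm //; lia.
Qed.

Let cl_ml j : (j < q)%N -> (c j + l p :=: m j + l p)%MS.
Proof.
move=> ltj; have [cm ncl _] := cP ltj; have [rl _ _ _ _] := gr.
have s_cm : (c j + l p <= m j + l p)%MS by apply: addsmxS.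
apply/eqmxP; rewrite -(mxrank_leqif_eq s_cm) rank_ml //.
have nzc : c j != 0 by apply: contraNneq ncl => ->; rewrite sub0mx.
rewrite mxrank_disjoint_sum ?rank_rV ?nzc ?rl //.
apply/eqP/rowV0P => v; rewrite sub_capmx => /andP[/sub_rVP[a ->]].
have [->|nza] := eqVneq a 0; first by rewrite scale0r.
by rewrite eqmx_scale // (negPf ncl).
Qed.

(** Different [m j] leave different traces on the new plane: otherwise the 4-dimensional [m j + m r]
    would fit into the 3-dimensional [m r + l p]. *)
Let nsub j r : (j < q)%N -> (r < q)%N -> j != r -> ~~ (c j <= m r + l p)%MS.
Proof.
case: gr => rl rm sl sm me ltj ltr ne_jr; apply/negP => cml.
have : (m j + m r <= m r + l p)%MS.
  rewrite addsmx_sub addsmxSl andbT (submx_trans (addsmxSl _ (l p))) // -cl_ml //.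
  by rewrite addsmx_sub cml addsmxSr.
by move/mxrankS; rewrite rank_ml // mxrank_disjoint_sum ?sm // !rm.
Qed.

Let gen r : S := \prod_(j < r) linform (c j).

Let gen_prime r B : lin_ideal (B : 'M[k]_N) (gen r) ->
  exists2 j, (j < r)%N & (c j <= B)%MS.
Proof.
have [_ n1 pr] := lin_ideal_prime B; rewrite /gen.
elim: r => [|r IHr]; first by rewrite big_ord0.
rewrite big_ord_recr /= => /pr[/IHr[j ltj cB]|/lin_ideal_linformE cB].
  by exists j => //; apply: ltnW.
by exists r.
Qed.

Let gen_mem : grid_ideal p q l m (gen q).
Proof.
split=> i lti; rewrite /gen.
  have ltiq := leq_trans lti lepq; have [_ _ /(_ lti) cl] := cP ltiq.
  rewrite (bigD1 (Ordinal ltiq)) //= mulrC; exact: lin_ideal_mul.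
have [cm _ _] := cP lti.
rewrite (bigD1 (Ordinal lti)) //= mulrC; exact: lin_ideal_mul.
Qed.

(* A form vanishing on all m j vanishes, restricted to the new line, at q distinct points. *)
Let gen_principal h r : (r <= q)%N -> (forall j, (j < q)%N -> lin_ideal (m j) h) ->
  exists h', lin_ideal (l p) (h - h' * gen r).
Proof.
move=> ler Hh; elim: r ler => [|r IHr] ler.
  exists h; rewrite /gen big_ord0 mulr1 subrr; by case: (lin_ideal_ideal (l p)).
have [h' lh'] := IHr (ltnW ler).
have [idP _ pr] := lin_ideal_prime (m r + l p)%MS.
have : lin_ideal (m r + l p)%MS (h' * gen r).
  have -> : h' * gen r = h - (h - h' * gen r) by ring.
  apply: (ideal_predB idP).
    by apply: lin_idealS (Hh r ler); apply: addsmxSl.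
  by apply: lin_idealS lh'; apply: addsmxSr.
case/pr => [|/gen_prime[j ltjr]]; last first.
  by rewrite (negPf (nsub _ ler _)) ?(ltn_trans ltjr) // ltn_eqF.
move=> h'm; have : lin_ideal (c r + l p)%MS h' by apply: lin_idealS h'm; rewrite cl_ml.
case/lin_ideal_addr => g [h'' [lg def_h']]; exists h''.
have [_ D M] := lin_ideal_ideal (l p).
have -> : h - h'' * gen r.+1 = (h - h' * gen r) + gen r * g.
  by rewrite /gen big_ord_recr /= def_h'; ring.
by apply: D => //; apply: M.
Qed.

(** For the new ideal J, the old ideal is J + ([gen q]) because its restriction to the new plane is
    principal, and the colon ideal of J by [gen q] is the ideal of the new plane; the extension
    lemma applies. *)
Lemma weakly_regular_line fs : weakly_regular (lin_ideal (l p)) fs ->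
  weakly_regular (grid_ideal p q l m) fs -> weakly_regular (grid_ideal p.+1 q l m) fs.
Proof.
move=> regl regI.
have [idl _ prl] := lin_ideal_prime (l p); have idI := grid_ideal_ideal p q l m.
have [_ ID IM] := idI; have [_ _ lM] := idl.
have gridS h : grid_ideal p.+1 q l m h <-> grid_ideal p q l m h /\ lin_ideal (l p) h.
  split=> [[hl hm]|[[hl hm] hp]].
    by split; [split=> // i lti; apply: hl; apply: ltnW | apply: hl].
  by split=> // i; rewrite ltnS leq_eqVlt => /predU1P[->|] //; apply: hl.
have ngen : ~ lin_ideal (l p) (gen q).
  by move=> /gen_prime[j ltj]; have [_ /negPf->] := cP ltj.
apply: (weakly_regular_extension (e := gen q) _ _ _ regI regl) => [|h|h].
- exact: grid_ideal_ideal.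
- split=> [Ih|[g [d [/gridS[Ig _] ->]]]]; last by apply: ID => //; apply: IM.
  have [h' lh'] := gen_principal (leqnn q) Ih.2.
  exists (h - h' * gen q), h'; split; last by rewrite subrK.
  by apply/gridS; split=> //; apply: ideal_predB => //; apply: IM.
split=> [lh|/gridS[_ /prl[]//]].
by apply/gridS; split; [apply: IM | apply: (ideal_predMr _ idl)].
Qed.

End OneLine.

Lemma weakly_regular_add p q l m fs : grid p.+1 q l m -> (p <= q)%N ->
  weakly_regular (lin_ideal (l p)) fs ->
  weakly_regular (grid_ideal p q l m) fs -> weakly_regular (grid_ideal p.+1 q l m) fs.
Proof.
by move=> gr lepq; have [c cP] := grid_forms gr; apply: (weakly_regular_line gr lepq cP).
Qed.

Lemma grid_ideal_sym p q l m h : grid_ideal p q l m h <-> grid_ideal q p m l h.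
Proof. by split=> -[]. Qed.

Lemma weakly_regular_grid a b l m fs : grid a b l m ->
  (forall i, (i < a)%N -> weakly_regular (lin_ideal (l i)) fs) ->
  (forall j, (j < b)%N -> weakly_regular (lin_ideal (m j)) fs) ->
  forall p, ((p <= a)%N -> (p <= b)%N -> weakly_regular (grid_ideal p p l m) fs) /\
    ((p <= a)%N -> (p < b)%N -> weakly_regular (grid_ideal p p.+1 l m) fs).
Proof.
move=> gr regl regm p.
have addm r : (r <= a)%N -> (r < b)%N -> weakly_regular (grid_ideal r r l m) fs ->
    weakly_regular (grid_ideal r r.+1 l m) fs.
  move=> ler ltr reg; apply: (eq_weakly_regular (J := grid_ideal r.+1 r m l)).
    by move=> h; apply: grid_ideal_sym.
  apply: weakly_regular_add => //; first exact/grid_sym/(grid_sub ler ltr).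
    exact: regm.
  by apply: eq_weakly_regular reg => h; apply: grid_ideal_sym.
elim: p => [|p [IHp IHpS]].
  have reg0 : weakly_regular (grid_ideal 0 0 l m) fs.
    by apply: weakly_regular_full => h; split.
  by split=> // _ b0; apply: addm.
have regS : (p.+1 <= a)%N -> (p.+1 <= b)%N -> weakly_regular (grid_ideal p.+1 p.+1 l m) fs.
  move=> ltpa ltpb; apply: weakly_regular_add => //.
  - exact: grid_sub ltpa ltpb gr.
  - exact: regl.
  - by apply: IHpS => //; apply: ltnW.
by split=> // lepa ltpb; apply: addm => //; apply: regS => //; apply: ltnW.
Qed.

End AddingLines.

(** * The balanced case *)

Section CMDirection.
Variables (k : fieldType) (N : nat).
Local Notation S := {mpoly k[N]}.
Implicit Types (l m : nat -> 'M[k]_N).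

Lemma dual_basis (L T : 'M[k]_N) : (L :&: T)%MS = 0 ->
  exists D : 'M[k]_(N, \rank T), row_base T *m D = 1%:M /\ L *m D = 0.
Proof.
move=> LT0; have TL0 : (T :&: L)%MS = 0 by rewrite -LT0 capmxC.
exists (proj_mx T L *m pinvmx (row_base T)); split.
  rewrite mulmxA proj_mx_id ?eq_row_base //.
  by rewrite mulmxVp ?row_base_free.
by rewrite mulmxA proj_mx_0 ?mul0mx.
Qed.

Lemma weakly_regular_complement (L T : 'M[k]_N) (P : 'I_(\rank T) -> {poly k}) :
  (L :&: T)%MS = 0 -> (forall i, P i != 0) ->
  weakly_regular (lin_ideal L)
    [seq poly_at (P i) (linform (row i (row_base T))) | i <- enum 'I_(\rank T)].
Proof.
move=> /dual_basis[D [TD LD]] nzP.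
apply: (weakly_regular_poly_at TD (lin_ideal_ideal L) nzP (enum_uniq _)) => i _.
by apply: coef_closed_lin_ideal; rewrite colE mulmxA LD mul0mx.
Qed.

(** The smallest prime of the chain contains a finite intersection of ideals, hence the ideal of one
    of the planes. *)
Lemma grid_prime_chain a b l m (M : S -> Prop) d : grid a b l m ->
  prime_chain_to (grid_ideal a b l m) M d -> (d.+2 <= N)%N.
Proof.
case=> rl rm _ _ _ [P [primeP ltP _]].
have primeP' i : (i <= d)%N -> is_prime_ideal (P i) by case/primeP.
have [prime0 sub0] := primeP 0%N isT.
pose J (x : 'I_a + 'I_b) : S -> Prop :=
  match x with inl i => lin_ideal (l i) | inr j => lin_ideal (m j) end.
have [||[i|j] sJP] := prime_ideal_inter (J := J) prime0.
- by case=> i; apply: lin_ideal_ideal.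
- move=> p Jp; apply: sub0; split=> i lti.
    exact: (Jp (inl (Ordinal lti))).
  exact: (Jp (inr (Ordinal lti))).
- by apply: (prime_chain_lin_le primeP' ltP _ sJP); rewrite rl.
- by apply: (prime_chain_lin_le primeP' ltP _ sJP); rewrite rm.
Qed.

Lemma grid_CohenMacaulay a b l m x y z w : grid a b l m -> ruled a b l m x y z w ->
  b = a \/ b = a.+1 -> CohenMacaulay_quotient (grid_ideal a b l m).
Proof.
move=> gr ru ab M maxM sIM d chain; have [idM nM1 _] := maxM.
have [T [rT capl capm]] := ruled_complement ru.
have /fin_all_exists[P HP] : forall i : 'I_(\rank T), exists P : {poly k},
    P != 0 /\ M (poly_at P (linform (row i (row_base T)))).
  by move=> i; apply: zariski.
have nzP i : P i != 0 by case: (HP i).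
set fs := [seq poly_at (P i) (linform (row i (row_base T))) | i <- enum 'I_(\rank T)].
have Mfs : {in fs, forall f, M f} by move=> _ /mapP[i _ ->]; case: (HP i).
have size_fs : size fs = \rank T by rewrite size_map size_enum_ord.
have reg : weakly_regular (grid_ideal a b l m) fs.
  have [i lti|j ltj|] := @weakly_regular_grid k N a b l m fs gr _ _ a.
  - by apply: weakly_regular_complement => //; apply: capl.
  - by apply: weakly_regular_complement => //; apply: capm.
  by move=> reg1 reg2; case: ab => eb; rewrite eb in reg1 reg2 *; [apply: reg1 | apply: reg2].
have led : (d <= size fs)%N.
  by rewrite size_fs; have := grid_prime_chain gr chain; lia.
(* The sequence has the maximal length [N - 2]; a shorter chain asks only for a prefix. *)
exists (take d fs); split; first by rewrite size_takel.
apply: regular_seq_inE => //; last exact: weakly_regular_take.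
by move=> f /mem_take/Mfs.
Qed.

End CMDirection.

(** * The unbalanced case *)

Section Pencil.
Variables (k : fieldType) (N : nat) (R : idomainType) (h : {rmorphism k -> R}).
Variables (f g : 'I_N -> R).
Local Notation S := {mpoly k[N]}.
Implicit Types (p q : S) (v : 'rV[k]_N).

Definition form_at (e : 'I_N -> R) v : R := \sum_i h (v 0 i) * e i.

(* The generic member 'X f + g of the pencil of points spanned by f and g; the outer
   variable records the degree. *)
Definition pencil : S -> {poly {poly R}} :=
  mmap ((@polyC _ \o @polyC _) \o h) (fun i => ((f i)%:P * 'X + (g i)%:P)%:P * 'X).

HB.instance Definition _ := GRing.RMorphism.on pencil.

Lemma pencil_linform v :
  pencil (linform v) = ((form_at f v)%:P * 'X + (form_at g v)%:P)%:P * 'X.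
Proof.
rewrite /pencil rmorph_linform /form_at !rmorph_sum mulr_suml -big_split /= rmorph_sum.
rewrite mulr_suml; apply: eq_bigr => i _ /=.
by rewrite mulrA -polyCM mulrDr !polyCM !mulrA.
Qed.

Lemma pencil_size p d : (size ((pencil p)`_d)%R <= d.+1)%N.
Proof.
elim/mpoly_ring_ind: p d => [c|i|p q IHp IHq|p q IHp IHq] d.
- rewrite [pencil _]mmapC /= coefC; case: d => [|d] /=; last by rewrite size_poly0.
  exact: size_polyC_leq1.
- rewrite -linform_delta pencil_linform coefCM coefX; case: d => [|[|d]] /=;
    rewrite ?mulr0 ?size_poly0 //.
  rewrite mulr1 (leq_trans (size_polyD _ _)) // geq_max (leq_trans (size_polyC_leq1 _)) // andbT.
  by rewrite mul_polyC (leq_trans (size_scale_leq _ _)) // size_polyX.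
- rewrite rmorphD coefD (leq_trans (size_polyD _ _)) // geq_max IHp IHq //.
- rewrite rmorphM /= coefM (leq_trans (size_sum _ _ _)) //; apply/bigmax_leqP => j _.
  apply: leq_trans (size_polyMleq _ _) _.
  apply: (@leq_trans (j.+1 + (d - j).+1).-1); last by have := ltn_ord j; lia.
  rewrite -!subn1; exact: (leq_sub2r 1 (leq_add (IHp j) (IHq (d - j)%N))).
Qed.

(** At the parameter [t] the member of the pencil is a point where all forms of [B] vanish. *)
Lemma pencil_root r (B : 'M[k]_(r, N)) t p d :
  (forall v, (v <= B)%MS -> form_at g v = - (h t * form_at f v)) -> lin_ideal B p ->
  root ((pencil p)`_d) (h t).
Proof.
move=> fgB; move: p d; suff main p : lin_ideal B p -> forall d, ((pencil p)`_d).[h t] = 0.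
  by move=> p d /main Hp; rewrite rootE Hp.
apply: (@lin_ideal_min _ _ _ _ (fun p => forall d, ((pencil p)`_d).[h t] = 0)).
  split=> [d|p1 q p10 q0 d|q p1 p10 d].
  - by rewrite rmorph0 coef0 horner0.
  - by rewrite rmorphD coefD hornerD p10 q0 addr0.
  - rewrite rmorphM coefM horner_sum big1 // => j _.
    by rewrite hornerM p10 mulr0.
move=> v /fgB gv d; rewrite pencil_linform coefMX gv; case: d => [|d] /=; first by rewrite horner0.
rewrite coefC; case: d => [|d] /=; last by rewrite horner0.
by rewrite hornerD hornerM hornerX !hornerC mulrC subrr.
Qed.

(** The coefficient of top degree in the parameter is the value at the point at infinity [f], where
    the forms of [B] vanish. *)
Lemma pencil_top r (B : 'M[k]_(r, N)) p d :
  (forall v, (v <= B)%MS -> form_at f v = 0) -> lin_ideal B p -> ((pencil p)`_d)`_d = 0.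
Proof.
move=> fB [s [sB ->]]; rewrite rmorph_sum coef_sum coef_sum big_seq big1 // => x s_x.
rewrite rmorphM /= pencil_linform fB ?(allP sB) // mul0r add0r mulrA coefMX.
case: d => [|d] /=; first by rewrite coef0.
rewrite coefMC coefMC nth_default ?mul0r //; exact: pencil_size.
Qed.

Lemma pencil_prod (c : nat -> 'rV[k]_N) d :
  ((pencil (\prod_(j < d) linform (c j)))`_d)`_d = \prod_(j < d) form_at f (c j).
Proof.
elim: d => [|d IHd]; first by rewrite !big_ord0 rmorph1 !coefC.
rewrite !big_ord_recr /= rmorphM /= pencil_linform mulrA coefMX /= coefMC mulrDr.
rewrite coefD mulrA coefMX /= !coefMC IHd [X in _ + X * _]nth_default ?mul0r ?addr0 //.
exact: pencil_size.
Qed.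

(* The restriction of s to a generic member of the pencil has degree r in the
   parameter 'X, and too many roots. *)
Lemma pencil_degree r r0 (B0 : 'M[k]_(r0, N)) (B : nat -> 'M[k]_N) (t : nat -> k)
    (c : nat -> 'rV[k]_N) (s : S) :
  (forall v, (v <= B0)%MS -> form_at f v = 0) ->
  (forall j v, (j <= r)%N -> (v <= B j)%MS -> form_at g v = - (h (t j) * form_at f v)) ->
  {in [pred j | j <= r]%N &, injective t} -> (forall j, (j <= r)%N -> lin_ideal (B j) s) ->
  lin_ideal B0 (\prod_(j < r) linform (c j) - s) ->
  exists2 j, (j < r)%N & form_at f (c j) = 0.
Proof.
move=> fB0 fgB inj_t sB sB0.
have G0 : (pencil s)`_r = 0.
  apply/eqP; apply: contraTT isT => nzG.
  have := max_poly_roots nzG (rs := [seq h (t j) | j <- iota 0 r.+1]).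
  rewrite size_map size_iota => lt.
  have /lt : all (root (pencil s)`_r) [seq h (t j) | j <- iota 0 r.+1].
    apply/allP => _ /mapP[j + ->]; rewrite mem_iota ltnS => /= lej.
    by apply: (pencil_root (B := B j)) => [v|]; [apply: fgB | apply: sB].
  rewrite ltnNge pencil_size; apply; rewrite map_comp (map_inj_uniq (fmorph_inj h)).
  rewrite map_inj_in_uniq ?iota_uniq // => i j; rewrite !mem_iota !ltnS => /= lei lej.
  exact: inj_t.
have := pencil_top r fB0 sB0; rewrite rmorphB coefB G0 subr0 pencil_prod => /eqP.
by case/prodf_eq0 => j _ /eqP; exists j.
Qed.

End Pencil.

(** * The irrelevant ideal and flags of linear primes *)

Section IrrelevantIdeal.
Variables (k : fieldType) (N : nat).
Local Notation S := {mpoly k[N]}.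

Lemma lin_ideal1_maximal : is_maximal_ideal (lin_ideal (1%:M : 'M[k]_N)).
Proof.
have [idM nM1 _] := lin_ideal_prime (1%:M : 'M[k]_N).
split=> // J idJ sMJ nJ1 p Jp; have [_ _ JM] := idJ.
have [c def_c] : exists c, lin_subst 0 p = c%:MP.
  elim/mpoly_ring_ind: p {Jp} => [c|i|p q [c Ec] [d Ed]|p q [c Ec] [d Ed]].
  - by exists c; apply: lin_substC.
  - by exists 0; rewrite lin_substX row0 linear0 mpolyC0.
  - by exists (c + d); rewrite rmorphD /= Ec Ed mpolyCD.
  - by exists (c * d); rewrite rmorphM /= Ec Ed mpolyCM.
have := @lin_subst_mod k N N 1%:M 0 p; rewrite subr0 submx_refl def_c => /(_ isT) Mpc.
have [c0|nzc] := eqVneq c 0; first by move: Mpc; rewrite c0 mpolyC0 subr0.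
case: nJ1; have Jc : J c%:MP.
  have -> : c%:MP = p - (p - c%:MP) by ring.
  by apply: (ideal_predB idJ) => //; apply: sMJ.
by have := JM c^-1%:MP _ Jc; rewrite -mpolyCM mulVf // mpolyC1.
Qed.

Lemma subspace_flag d (U : 'M[k]_N) : (\rank U + d = N)%N ->
  exists B : nat -> 'M[k]_N, [/\ B 0%N = U, row_full (B d)
    & forall i, (i < d)%N -> (B i <= B i.+1)%MS && ~~ (B i.+1 <= B i)%MS].
Proof.
elim: d U => [|d IHd] U rU.
  by exists (fun=> U); split=> //; rewrite -col_leq_rank; lia.
have /row_subPn[i nUi] : ~~ (1%:M <= U)%MS.
  by rewrite sub1mx -col_leq_rank -ltnNge; lia.
set v := row i _ in nUi.
have rUv : \rank (U + v)%MS = (\rank U).+1.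
  have nzv : v != 0 by apply: contraNneq nUi => ->; rewrite sub0mx.
  rewrite mxrank_disjoint_sum ?rank_rV ?nzv ?addn1 //.
  apply/eqP/rowV0P => c; rewrite sub_capmx => /andP[cU /sub_rVP[a def_c]].
  have [a0|nza] := eqVneq a 0; first by rewrite def_c a0 scale0r.
  by move: cU; rewrite def_c eqmx_scale // (negPf nUi).
have [|B [B0 fullB ltB]] := IHd (U + v)%MS; first by rewrite rUv addSnnS.
exists (fun j => if j is j'.+1 then B j' else U); split=> // -[_|j]; last exact: ltB.
rewrite B0 addsmxSl; apply/negP => /mxrankS; by rewrite rUv ltnn.
Qed.

Lemma lin_prime_chain d (U : 'M[k]_N) (I : S -> Prop) : (\rank U + d = N)%N ->
  (forall p, I p -> lin_ideal U p) -> prime_chain_to I (lin_ideal (1%:M : 'M[k]_N)) d.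
Proof.
move=> rU sIU; have [B [B0 fullB ltB]] := subspace_flag rU.
have sUB i : (i <= d)%N -> (U <= B i)%MS.
  elim: i => [|i IHi] lti; first by rewrite B0.
  by apply: submx_trans (IHi (ltnW lti)) _; case/andP: (ltB i lti).
exists (fun i => lin_ideal (B i)); split=> [i lei|i lti|p].
- split=> [|p /sIU]; [exact: lin_ideal_prime | exact/lin_idealS/sUB].
- have /andP[sB /row_subPn[j nBj]] := ltB i lti.
  split=> [p|]; first exact: lin_idealS.
  exists (linform (row j (B i.+1))); split; first exact/lin_ideal_linform/row_sub.
  by move/lin_ideal_linformE; rewrite (negPf nBj).
- by split; apply: lin_idealS; rewrite ?submx1 // sub1mx.
Qed.

Lemma lin_subst_lin_ideal r (B : 'M[k]_(r, N)) (Q : 'M[k]_N) p :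
  B *m Q = B -> lin_ideal B p -> lin_ideal B (lin_subst Q p).
Proof.
move=> BQ; have [I0 ID IM] := lin_ideal_ideal B.
apply: (@lin_ideal_min _ _ _ _ (fun p => lin_ideal B (lin_subst Q p))).
  split=> [|p1 q|q p1]; rewrite ?rmorph0 // ?rmorphD ?rmorphM; [exact: ID | exact: IM].
move=> v vB; rewrite lin_subst_linform; apply: lin_ideal_linform.
by have /submxP[D ->] := vB; rewrite -mulmxA BQ submxMl.
Qed.

Lemma free4_dual (x y z w : 'rV[k]_N) : free4 x y z w -> exists D : 'M[k]_(N, 4),
  forall a b c d, comb4 x y z w a b c d *m D = \row_(i < 4) [:: a; b; c; d]`_i.
Proof.
move=> fr; pose X : 'M[k]_(4, N) := \matrix_(i < 4) [:: x; y; z; w]`_i.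
have XE (v : 'rV[k]_4) : v *m X =
    comb4 x y z w (v 0 ord0) (v 0 (lift ord0 ord0)) (v 0 (lift ord0 (lift ord0 ord0)))
      (v 0 (lift ord0 (lift ord0 (lift ord0 ord0)))).
  by rewrite mulmx_sum_row !big_ord_recl big_ord0 !rowK /= addr0 !addrA.
exists (pinvmx X) => a b c d.
have freeX : row_free X.
  apply: inj_row_free => v; rewrite XE => /fr[v0 v1 v2 v3].
  apply/rowP => i; rewrite mxE; case: (unliftP ord0 i) => [i1|] -> //.
  case: (unliftP ord0 i1) => [i2|] -> //; case: (unliftP ord0 i2) => [i3|] -> //.
  by rewrite (ord1 i3).
rewrite -[RHS](mulmxKp freeX) XE; by rewrite !mxE.
Qed.

End IrrelevantIdeal.

Section NonCM.
Variables (k : fieldType) (N : nat).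
Local Notation S := {mpoly k[N]}.
Implicit Types (l m : nat -> 'M[k]_N) (u v x y z w : 'rV[k]_N).

(* On the ruling m, the affine parameter t j with m 0 at infinity. *)
Lemma ruled_param a b l m x y z w : grid a b l m -> ruled a b l m x y z w ->
  exists t : nat -> k, forall j, (0 < j < b)%N ->
    (m j :=: comb4 x y z w (- t j) 0 1 0 + comb4 x y z w 0 (- t j) 0 1)%MS.
Proof.
move=> [_ rm _ sm _] [fr m0 _ Hm].
suff : exists t : nat -> k, forall j, (j < b)%N -> (0 < j)%N ->
    (m j :=: comb4 x y z w (- t j) 0 1 0 + comb4 x y z w 0 (- t j) 0 1)%MS.
  by case=> t Ht; exists t => j /andP[j0 ltj]; apply: Ht.
apply: (@nat_choice k 0 b (fun j t => (0 < j)%N ->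
  (m j :=: comb4 x y z w (- t) 0 1 0 + comb4 x y z w 0 (- t) 0 1)%MS)) => j ltj.
have [s [t [nzst mj]]] := Hm j ltj.
have [j0|j0] := posnP j; first by exists 0; rewrite j0.
have nzt : t != 0.
  apply: contraTneq nzst => t0; rewrite t0 eqxx orbF negbK.
  have : comb4 x y z w s 0 0 0 = 0.
    apply: (skew_eq0 (sm 0%N j _ ltj _)); first exact: leq_trans ltj.
    - by rewrite neq_ltn j0.
    - by rewrite m0 /comb4 !scale0r !addr0 scalemx_sub ?addsmxSl.
    - by rewrite mj t0 addsmxSl.
  by case/fr=> ->.
exists (- (t^-1 * s)) => _; rewrite opprK; apply: eqmx_trans mj _.
apply: eqmx_trans (eqmx_sym (span2_scale _ _ (invr_neq0 nzt) (invr_neq0 nzt))) _.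
by rewrite !comb4Z !mulr0 mulVf.
Qed.

Lemma ruled_param_inj a b l m x y z w (t : nat -> k) : grid a b l m -> free4 x y z w ->
  (forall j, (0 < j < b)%N ->
     (m j :=: comb4 x y z w (- t j) 0 1 0 + comb4 x y z w 0 (- t j) 0 1)%MS) ->
  forall i j, (0 < i < b)%N -> (0 < j < b)%N -> t i = t j -> i = j.
Proof.
move=> [_ _ _ sm _] fr Ht i j lti ltj eqt; apply/eqP; apply: contraT => ne_ij.
have : comb4 x y z w (- t i) 0 1 0 = 0.
  apply: (skew_eq0 (sm i j _ _ ne_ij)); rewrite ?Ht //.
  - by case/andP: lti.
  - by case/andP: ltj.
  - exact: addsmxSl.
  - by rewrite eqt addsmxSl.
by case/fr=> _ _ /eqP; rewrite oner_eq0.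
Qed.

Section Witness.
Variables (a b : nat) (l m : nat -> 'M[k]_N) (x y z w : 'rV[k]_N).
Hypotheses (gr : grid a b l m) (ru : ruled a b l m x y z w) (ltab : (a.+2 <= b)%N).
Local Notation V := (x + y + z + w)%MS.
Local Notation I := (grid_ideal a b l m).

(** The shift from [j] to [j.+1] lets the product of these [b.-2] forms miss exactly the first and
    last lines [m]; since [a.+2 <= b], the indices reach every [l j]. *)
Lemma grid_witness_forms : exists c : nat -> 'rV[k]_N, forall j, (j < b.-2)%N ->
  [/\ (c j <= m j.+1)%MS, c j != 0 & (j < a)%N -> (c j <= l j)%MS].
Proof.
case: gr => rl rm sl sm me; apply: (@nat_choice 'rV[k]_N 0 b.-2 (fun j c =>
  [/\ (c <= m j.+1)%MS, c != 0 & (j < a)%N -> (c <= l j)%MS])) => j ltj.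
have ltjb : (j.+1 < b)%N by lia.
have [lta|lea] := ltnP j a.
  by have [c [nzc cl cm]] := cap_pick (rank1_neq0 (me j j.+1 lta ltjb)); exists c.
exists (nz_row (m j.+1)); split=> //; first exact: nz_row_sub.
by rewrite nz_row_eq0 -mxrank_eq0 rm.
Qed.

Lemma ruled_split v : (v <= V)%MS -> exists v0 v1,
  [/\ v = v0 + v1, (v0 <= m 0%N)%MS & (v1 <= m b.-1)%MS].
Proof.
have [rl rm sl sm me] := gr; have [_ sV] := ruled_sub ru.
have lt0 : (0 < b)%N by lia.
have lt1 : (b.-1 < b)%N by lia.
have sub : (m 0%N + m b.-1 <= V)%MS by rewrite addsmx_sub !sV.
have /eqmxP eqV : (m 0%N + m b.-1 == V)%MS.
  rewrite -(mxrank_leqif_eq sub) (free4_rank (ruled_free ru)).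
  by rewrite mxrank_disjoint_sum ?rm // sm //; lia.
rewrite -eqV => /sub_addsmxP[[d0 d1] /= ->].
by exists (d0 *m m 0%N), (d1 *m m b.-1); rewrite !submxMl.
Qed.

Variables (beta b0 b1 : 'rV[k]_N) (c : nat -> 'rV[k]_N).
Hypotheses (betaV : (beta <= V)%MS)
  (betal : forall i, (i < a)%N -> ~~ (beta <= l i)%MS)
  (betam : forall j, (j < b)%N -> ~~ (beta <= m j)%MS)
  (def_beta : beta = b0 + b1) (b0m : (b0 <= m 0%N)%MS) (b1m : (b1 <= m b.-1)%MS)
  (cP : forall j, (j < b.-2)%N ->
     [/\ (c j <= m j.+1)%MS, c j != 0 & (j < a)%N -> (c j <= l j)%MS]).

Let gam : S := \prod_(j < b.-2) linform (c j).
Let wit : S := gam * linform b1.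

Let gam_l i q : (i < a)%N -> lin_ideal (l i) (q * gam).
Proof.
move=> lti; have ltib : (i < b.-2)%N by lia.
have [_ _ /(_ lti) cl] := cP ltib.
rewrite /gam (bigD1 (Ordinal ltib)) //= mulrCA mulrC; exact: lin_ideal_mul.
Qed.

Let gam_m j q : (0 < j)%N -> (j < b.-1)%N -> lin_ideal (m j) (q * gam).
Proof.
case: j => // j _ ltj; have ltjb : (j < b.-2)%N by lia.
have [cm _ _] := cP ltjb.
rewrite /gam (bigD1 (Ordinal ltjb)) //= mulrCA mulrC; exact: lin_ideal_mul.
Qed.

Let m_cases j : (j < b)%N -> [\/ j = 0%N, j = b.-1 | (0 < j)%N /\ (j < b.-1)%N].
Proof.
move=> ltj; have [|j0] := posnP j; first by constructor 1.
by have [|] := ltnP j b.-1 => ?; [constructor 3 | constructor 2; lia].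
Qed.

(** With [v = v0 + v1] as for [beta], the product [v * b1] is [(v0 * b1 - v1 * b0) + v1 * beta]. The
    determinant vanishes on [m 0] and [m b.-1], and the factor [gam] on all other planes. *)
Let wit_mul v : (v <= V)%MS -> ideal_adjoin I (linform beta) (linform v * wit).
Proof.
move=> /ruled_split[v0 [v1 [-> v0m v1m]]].
exists ((linform v0 * linform b1 - linform v1 * linform b0) * gam), (gam * linform v1).
split; last by rewrite /wit def_beta !linearD /=; ring.
split=> [i lti|j /m_cases[->|->|[j0 ltj]]]; [exact: gam_l | | | exact: gam_m].
- have idJ := lin_ideal_ideal (m 0%N).
  apply: (ideal_predMr _ idJ); apply: (ideal_predB idJ).
    by rewrite mulrC; apply: lin_ideal_mul.
  exact: lin_ideal_mul.
- have idJ := lin_ideal_ideal (m b.-1).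
  apply: (ideal_predMr _ idJ); apply: (ideal_predB idJ).
    exact: lin_ideal_mul.
  by rewrite mulrC; apply: lin_ideal_mul.
Qed.

(** Cancelling [beta] modulo each prime shows that [s] vanishes on all [m j] with [j > 0] and agrees
    with [gam] on [m 0]; the degree bound along a pencil excludes this. *)
Let wit_notin s : ~ I (wit - s * linform beta).
Proof.
move=> [_ Im]; have [t Ht] := ruled_param gr ru.
have fr := ruled_free ru; have [D DE] := free4_dual fr.
have lt0 : (0 < b)%N by lia.
have sm j : (0 < j)%N -> (j < b)%N -> lin_ideal (m j) s.
  move=> j0 ltj; have [idJ _ pr] := lin_ideal_prime (m j).
  have : lin_ideal (m j) (s * linform beta).
    have -> : s * linform beta = wit - (wit - s * linform beta) by ring.
    apply: (ideal_predB idJ) => //; last exact: Im.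
    rewrite /wit; case: (m_cases ltj) => [j00|->|[_ ltj1]]; first by rewrite j00 in j0.
      exact: lin_ideal_mul.
    by rewrite mulrC; apply: gam_m.
  by case/pr=> // /lin_ideal_linformE; rewrite (negPf (betam ltj)).
have sm0 : lin_ideal (m 0%N) (gam - s).
  have [idJ _ pr] := lin_ideal_prime (m 0%N).
  have : lin_ideal (m 0%N) ((gam - s) * linform beta).
    have -> : (gam - s) * linform beta = (wit - s * linform beta) + gam * linform b0.
      by rewrite /wit def_beta linearD /=; ring.
    case: (idJ) => _ JD _; apply: JD; [exact: Im | exact: lin_ideal_mul].
  by case/pr=> // /lin_ideal_linformE; rewrite (negPf (betam lt0)).
(* In the coordinates (x, y, z, w) the pencil is the generic point (T, 1, X T, X) of the quadric, T
   being the variable of [{poly k}]. The forms of [m j] vanish at X = [t j], those of [m 0] at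
   infinity. *)
pose f (i : 'I_N) : {poly k} := (D i (inord 2))%:P * 'X + (D i (inord 3))%:P.
pose g (i : 'I_N) : {poly k} := (D i (inord 0))%:P * 'X + (D i (inord 1))%:P.
have formE (p q : 'I_4) v :
    form_at (@polyC k) (fun i => (D i p)%:P * 'X + (D i q)%:P) v =
      ((v *m D) 0 p)%:P * 'X + ((v *m D) 0 q)%:P.
  rewrite /form_at !mxE !rmorph_sum mulr_suml -big_split /=; apply: eq_bigr => i _.
  by rewrite !polyCM mulrDr mulrA.
have fE p q r d : form_at (@polyC k) f (comb4 x y z w p q r d) = r%:P * 'X + d%:P.
  by rewrite formE DE !mxE !inordK.
have gE p q r d : form_at (@polyC k) g (comb4 x y z w p q r d) = p%:P * 'X + q%:P.
  by rewrite formE DE !mxE !inordK.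
have [|j v lej|j j'|j lej||j ltj] := @pencil_degree k N {poly k} (@polyC k) f g b.-2 N (m 0%N)
    (fun j => m j.+1) (fun j => t j.+1) c s.
- move=> v; rewrite (ruled_m0 ru) => /sub_span2P[p [q ->]].
  have -> : p *: x + q *: y = comb4 x y z w p q 0 0 by rewrite /comb4 !scale0r !addr0.
  by rewrite fE mul0r addr0.
- rewrite Ht; last by lia.
  case/sub_span2P=> p [q ->]; rewrite !comb4Z comb4D fE gE.
  by rewrite !mulr0 !mulr1 !add0r !addr0 !polyCM !polyCN; ring.
- rewrite !inE => lej lej' eqt.
  have [] : j.+1 = j'.+1 by apply: (ruled_param_inj gr fr Ht) => //; lia.
  by [].
- by apply: sm; lia.
- exact: sm0.
(* On [m j.+1] the value at [f] is p T + q in the basis of that line, so it vanishes only for the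
   zero form. *)
have [cm nzc _] := cP ltj; move: cm; rewrite Ht; last by lia.
case/sub_span2P=> p [q def_c]; rewrite def_c !comb4Z comb4D fE => f0.
case/eqP: nzc; rewrite def_c.
move: f0; rewrite !mulr0 !mulr1 add0r addr0 => f0.
have p0 : p = 0.
  by have := congr1 (fun F : {poly k} => F`_1) f0; rewrite coefD coefMX !coefC /= addr0.
have q0 : q = 0.
  by have := congr1 (fun F : {poly k} => F`_0) f0; rewrite coefD coefMX !coefC /= add0r.
by rewrite p0 q0 !scale0r addr0.
Qed.

Lemma grid_not_CohenMacaulay_aux : ~ CohenMacaulay_quotient I.
Proof.
have [rl rm sl sm me] := gr; have [slV smV] := ruled_sub ru.
have lt0 : (0 < b)%N by lia.
have fr := ruled_free ru; have rV := free4_rank fr.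
have N4 : (4 <= N)%N by rewrite -rV rank_leq_col.
pose Q := proj_mx V V^C%MS.
have VC0 : (V :&: V^C)%MS = 0 by apply: capmx_compl.
have QV r (B : 'M[k]_(r, N)) : (B <= V)%MS -> B *m Q = B by apply: proj_mx_id.
have [D [TD VD]] := dual_basis VC0.
have rW : \rank (V^C)%MS = (N - 4)%N by rewrite mxrank_compl rV.
set T := row_base (V^C)%MS in TD.
pose ts := [seq linform (row i T) | i <- enum 'I_(\rank V^C)].
have idI : ideal_pred I := grid_ideal_ideal a b l m.
have reg_gs : weakly_regular I (linform beta :: ts).
  split=> [h [hl hm]|].
    split=> i lti.
      have [_ _ pr] := lin_ideal_prime (l i).
      by case/pr: (hl i lti) => // /lin_ideal_linformE; rewrite (negPf (betal lti)).
    have [_ _ pr] := lin_ideal_prime (m i).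
    by case/pr: (hm i lti) => // /lin_ideal_linformE; rewrite (negPf (betam lti)).
  have -> : ts = [seq poly_at 'X (linform (row i T)) | i <- enum 'I_(\rank V^C)].
    by apply: eq_map => i; rewrite /poly_at map_polyX hornerX.
  apply: (weakly_regular_poly_at (P := fun=> 'X) TD) => [|i||i _].
  - exact: ideal_adjoin_ideal.
  - by rewrite polyX_eq0.
  - exact: enum_uniq.
  have BD r (B : 'M[k]_(r, N)) : (B <= V)%MS -> B *m col i D = 0.
    by case/submxP=> E ->; rewrite -mulmxA colE (mulmxA V) VD mul0mx mulmx0.
  apply: coef_closed_adjoin; first exact/coord_expand_fixed/BD.
  move=> h [hl hm] d; split=> j ltj.
    by apply: coef_closed_lin_ideal (hl j ltj) d; apply/BD/slV.
  by apply: coef_closed_lin_ideal (hm j ltj) d; apply/BD/smV.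
(* The flag from [m 0] to the irrelevant ideal has length [N - 2], so a regular sequence of that
   length would exist there, one longer than [linform beta :: ts]. *)
move=> CM; have [||fs [size_fs reg]] := CM _ (lin_ideal1_maximal k N) _ (N - 2)%N.
- move=> p [_ /(_ 0%N lt0)]; apply: lin_idealS; exact: submx1.
- apply: (lin_prime_chain (U := m 0%N)); first by rewrite rm // subnKC // (leq_trans _ N4).
  by move=> p [_]; apply.
have Mfs : {in fs, forall f, lin_ideal (1%:M : 'M[k]_N) f}.
  by case: reg => H _ _ f /(nthP 0)[i lti <-]; apply: H.
have idJ := ideal_adjoins_ideal (linform beta :: ts) idI.
have Jwit v : ideal_adjoins I (linform beta :: ts) (linform v * wit).
  have /sub_addsmxP[[d1 d2] /= ->] : (v <= V + V^C)%MS.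
    by rewrite (submx_full) // addsmx_compl_full.
  have [J0 JD JM] := idJ.
  rewrite linearD mulrDl; apply: JD.
    apply: (@ideal_adjoins_sub _ (ideal_adjoin I (linform beta)) ts).
    by apply: wit_mul; apply: submxMl.
  have /submxP[d3 ->] : (d2 *m V^C%MS <= T)%MS by rewrite eq_row_base submxMl.
  rewrite mulmx_sum_row linear_sum mulr_suml; apply: ideal_pred_sum => // i.
  rewrite linearZ /= -mul_mpolyC mulrAC; apply: JM; apply: ideal_adjoins_mem => //.
  by rewrite inE; apply/orP; right; apply: map_f; rewrite mem_enum.
have : ideal_adjoins I (linform beta :: ts) wit.
  apply: (weakly_regular_length idI (regular_seq_in_weakly reg) reg_gs).
    by rewrite size_fs /= size_map size_enum_ord rW; lia.
  move=> f /Mfs; apply: (@lin_ideal_min _ _ _ _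
    (fun f => ideal_adjoins I (linform beta :: ts) (f * wit))) => [|v _]; last exact: Jwit.
  have [J0 JD JM] := idJ; split=> [|p q|q p]; rewrite ?mul0r ?mulrDl -?mulrA //.
    exact: JD.
  exact: JM.
(* The substitution [Q] kills the extra coordinates [ts] and fixes the forms in the span of [x],
   [y], [z], [w], which brings membership of [wit] down to the ideal generated by [I] and [beta]. *)
pose J' p := exists s, I (lin_subst Q p - s * linform beta).
have [I0 ID IM] := idI.
have idJ' : ideal_pred J'.
  split=> [|p q [s Ip] [s' Iq]|q p [s Ip]].
  - by exists 0; rewrite rmorph0 mul0r subrr.
  - exists (s + s'); rewrite rmorphD mulrDl opprD addrACA; exact: ID.
  - exists (lin_subst Q q * s); rewrite rmorphM -mulrA -mulrBr; exact: IM.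
have Qfix v : (v <= V)%MS -> lin_subst Q (linform v) = linform v.
  by move=> vV; rewrite lin_subst_linform QV.
move=> adj_wit; have [p [pl pm]|g|s] := ideal_adjoins_min idJ' _ _ adj_wit.
- exists 0; rewrite mul0r subr0; split=> i lti.
    by apply: lin_subst_lin_ideal; [apply/QV/slV | apply: pl].
  by apply: lin_subst_lin_ideal; [apply/QV/smV | apply: pm].
- rewrite inE => /predU1P[->|/mapP[i _ ->]].
    by exists 1; rewrite Qfix // mul1r subrr.
  exists 0; rewrite mul0r subr0 lin_subst_linform /Q proj_mx_0 ?linear0 //.
  by rewrite (submx_trans (row_sub i T)) // eq_row_base.
suff -> : lin_subst Q wit = wit by apply: wit_notin.
rewrite /wit rmorphM /= Qfix ?(submx_trans b1m) ?smV //; last by lia.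
congr (_ * _); rewrite /gam rmorph_prod; apply: eq_bigr => j _; apply: Qfix.
have [cm _ _] := cP (ltn_ord j); apply: submx_trans cm _; apply: smV.
by have := ltn_ord j; lia.
Qed.

End Witness.

Lemma grid_not_CohenMacaulay a b l m x y z w : grid a b l m -> ruled a b l m x y z w ->
  (a.+2 <= b)%N -> ~ CohenMacaulay_quotient (grid_ideal a b l m).
Proof.
move=> gr ru ltab; have [c cP] := grid_witness_forms gr ltab.
have [t1 [t2 [/free2_neq0[nzt _] tV capl capm]]] := ruled_transversal ru.
have t1T : (t1 <= t1 + t2)%MS := addsmxSl _ _.
have [b0 [b1 [def_t b0m b1m]]] := ruled_split gr ru ltab (submx_trans t1T tV).
(* [beta] is a nonzero vector of the transversal space, hence lies in none of the lines. *)
apply: (grid_not_CohenMacaulay_aux gr ru ltab _ _ _ def_t b0m b1m cP).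
- exact: submx_trans tV.
- move=> i lti; apply: contra nzt => tl; apply/eqP; exact: skew_eq0 (capl i lti) tl t1T.
- move=> j ltj; apply: contra nzt => tm; apply/eqP; exact: skew_eq0 (capm j ltj) tm t1T.
Qed.

End NonCM.

(** * Arrangements *)

Lemma rank_cap_annihilators (k : fieldType) (N : nat) (A B : 'M[k]_N) :
  \rank (kermx A^T :&: kermx B^T)%MS = (N - \rank (A + B)%MS)%N.
Proof.
have kerE (C : 'M[k]_N) (v : 'rV[k]_N) : (v <= kermx C^T)%MS = (C <= kermx v^T)%MS.
  by rewrite !sub_kermx -trmx_eq0 trmx_mul trmxK.
rewrite -(mxrank_tr (A + B)%MS) -mxrank_ker; apply: eqmx_rank; apply/rV_eqP => v.
by rewrite sub_capmx (kerE A) (kerE B) (kerE (A + B)%MS) addsmx_sub.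
Qed.

Lemma eq_CohenMacaulay (k : fieldType) (N : nat) (I J : {mpoly k[N]} -> Prop) :
  (forall p, I p <-> J p) -> CohenMacaulay_quotient I -> CohenMacaulay_quotient J.
Proof.
move=> eqIJ CM M maxM sJM d [P [primeP ltP PM]].
have [||fs [size_fs reg]] := CM M maxM _ d.
- by move=> p /eqIJ/sJM.
- exists P; split=> // i lei; have [pr sJP] := primeP i lei.
  by split=> // p /eqIJ/sJP.
exists fs; split=> //; have [idM nM1 _] := maxM; have [Mfs _ _] := reg.
apply: regular_seq_inE => // [f /(nthP 0)[i lti <-]|]; first exact: Mfs.
exact: eq_weakly_regular eqIJ (regular_seq_in_weakly reg).
Qed.

Section Arrangement.
Variables (k : fieldType) (n m a b : nat) (A : 'I_m -> 'M[k]_n.+1).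
Hypotheses (n3 : (3 <= n)%N) (rankA : forall i, \rank (A i) = n.-1)
  (inclA : forall i j, (A i <= A j)%MS -> i = j).
Variables (sigma : 'I_m -> 'I_a + 'I_b) (tau : 'I_a + 'I_b -> 'I_m).
Hypotheses (sigmaK : cancel sigma tau) (tauK : cancel tau sigma)
  (incA : forall i j, incident A i j = Kab (sigma i) (sigma j)).

Let B x : 'M[k]_n.+1 := kermx (A (tau x))^T.

Let rankB x : \rank (B x) = 2%N.
Proof. by rewrite mxrank_ker mxrank_tr rankA; lia. Qed.

(** Without inclusions the sum of two planes has rank [n] or [n.+1]. They are incident exactly when
    it is a hyperplane, and the annihilators then share one form up to scalars; otherwise they are
    skew. *)
Let rankBB x y : x != y -> \rank (B x :&: B y)%MS = Kab x y :> nat.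
Proof.
move=> ne_xy; have ne_tau : tau x != tau y by rewrite (can_eq tauK).
have := incA (tau x) (tau y); rewrite !tauK /incident ne_tau /= => <-.
rewrite rank_cap_annihilators; have := mxrank_sum_cap (A (tau x)) (A (tau y)).
rewrite !rankA; set s := \rank (_ + _)%MS; set c := \rank (_ :&: _)%MS => sc.
have s_le : (s <= n.+1)%N by apply: rank_leq_col.
have s_gt : (n.-1 < s)%N.
  rewrite ltnNge; apply/negP => les; have sub := addsmxSl (A (tau x)) (A (tau y)).
  have /andP[_] : (A (tau x) == A (tau x) + A (tau y))%MS.
    by rewrite -(mxrank_leqif_eq sub) eqn_leq mxrankS //= rankA.
  rewrite addsmx_sub => /andP[_ /inclA eq_tau].
  by rewrite eq_tau eqxx in ne_tau.
by case: (leqP (n - 2)%N c) => ltc /=; lia.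
Qed.

(** The value 0 outside the range is never consulted: all conditions on a grid are bounded. *)
Let l i := if insub i is Some i' then B (inl i') else 0.
Let r j := if insub j is Some j' then B (inr j') else 0.

Lemma arrangement_grid : grid a b l r /\
  (forall p, grid_ideal a b l r p <-> arrangement_ideal A p).
Proof.
have lE i (lti : (i < a)%N) : l i = B (inl (Ordinal lti)) by rewrite /l insubT.
have rE j (ltj : (j < b)%N) : r j = B (inr (Ordinal ltj)) by rewrite /r insubT.
split; last first.
  move=> p; split=> [[pl pr] i|Ap].
    apply/subspace_idealE; rewrite -(sigmaK i) -/(B (sigma i)).
    case: (sigma i) => [[j ltj]|[j ltj]]; first by rewrite -lE; apply: pl.
    by rewrite -rE; apply: pr.
  by split=> i lti; rewrite ?lE ?rE; apply/subspace_idealE/Ap.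
split=> [i lti|j ltj|i i' lti lti' ne|j j' ltj ltj' ne|i j lti ltj].
- by rewrite lE rankB.
- by rewrite rE rankB.
- by rewrite !lE; apply/eqP; rewrite -mxrank_eq0 rankBB.
- by rewrite !rE; apply/eqP; rewrite -mxrank_eq0 rankBB.
- by rewrite lE rE rankBB.
Qed.

End Arrangement.

Theorem theorem1p2 (k : fieldType) (n m a b : nat) (A : 'I_m -> 'M[k]_(n.+1)) :
  (3 <= n)%N ->
  (forall i, \rank (A i) = n.-1) ->
  (forall i j, (A i <= A j)%MS -> i = j) ->
  (0 < a)%N -> (0 < b)%N ->
  [\/ (a <= b <= 2)%N, [&& (2 <= a)%N, (a <= b)%N & (b <= 3)%N] | (3 <= a <= b)%N] ->
  (exists sigma : 'I_m -> 'I_a + 'I_b,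
      bijective sigma /\ forall i j, incident A i j = Kab (sigma i) (sigma j)) ->
  (ACM A <-> (b = a \/ b = a.+1)).
Proof.
move=> n3 rankA inclA a0 b0 cases [sigma [[tau sigmaK tauK] incA]].
have [gr eqI] := arrangement_grid n3 rankA inclA sigmaK tauK incA.
set l := (fun i => _) in gr eqI; set r := (fun j => _) in gr eqI.
have leab : (a <= b)%N by case: cases; lia.
have [x [y [z [w ru]]]] : exists x y z w, ruled a b l r x y z w.
  by apply: grid_ruled => //; case: cases; lia.
split=> [CM|ab]; last exact: eq_CohenMacaulay eqI (grid_CohenMacaulay gr ru ab).
have [lt|] := ltnP a.+1 b; last by lia.
case: (grid_not_CohenMacaulay gr ru lt).
by apply: eq_CohenMacaulay CM => p; split=> /eqI.
Qed.
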